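(* Let $n$ be sufficiently large and let $F$ be a tree of order $\ell\geq 4$. Let $A,B$ be the two partite sets of $F$ with $|A|\leq|B|$ and $\delta=\min\{d_F(x):x\in A\}$. (i) If $\ell$ is even, then ${\rm SPEX}(n,F)=\{S_{n,(\ell-2)/2}^{0}\}$ if and only if $\beta(F)=\ell/2$. (ii) If $\ell$ is odd, then ${\rm SPEX}(n,F)=\{S_{n,(\ell-3)/2}^{1}\}$ if and only if $\beta(F)=(\ell-1)/2$ and $\delta\geq 2$.
   Context: $\beta(F)$ is the minimum size of a vertex cover of $F$ (a set of vertices meeting every edge). $\rho(G)$ is the adjacency spectral radius; ${\rm spex}(n,F)$ is the maximum of $\rho(G)$ over $F$-free graphs on $n$ vertices and ${\rm SPEX}(n,F)$ the set of $F$-free $n$-vertex graphs attaining it. For integers $n>k>0$ and $0\leq p\leq\lfloor (n-k)/2\rfloor$, $S_{n,k}^{p}$ is obtained from the join $K_k\nabla (n-k)K_1$ by adding $p$ pairwise disjoint edges inside the independent set of size $n-k$. *)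

(* Defs.v *)
From HB Require Import structures.
From mathcomp Require Import all_boot all_order all_algebra.
From mathcomp Require Import reals complex.

Set Implicit Arguments.
Unset Strict Implicit.
Unset Printing Implicit Defensive.

Import Order.TTheory GRing.Theory Num.Theory.

Section SimpleGraph.
Variable T : finType.

Definition simple_adj (E : {set T * T}) : bool :=
  [forall x, forall y, ((x, y) \in E) ==> (x != y) && ((y, x) \in E)].

(* Stored as the set of ordered pairs of adjacent vertices, so that the graphs
   on T form a finType and extremal values can be taken over all of them. *)
Record sgraph := SGraph { arcs : {set T * T}; _ : simple_adj arcs }.

HB.instance Definition _ := [isSub for arcs].
HB.instance Definition _ := [Finite of sgraph by <:].

Definition adj (G : sgraph) : rel T := fun x y => (x, y) \in arcs G.

Definition degree (G : sgraph) (x : T) : nat := #|[set y | adj G x y]|.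

Definition independent (G : sgraph) (A : {set T}) : Prop :=
  {in A &, forall x y, ~~ adj G x y}.

Definition partite_sets (G : sgraph) (A B : {set T}) : Prop :=
  [/\ A :|: B = setT, [disjoint A & B], independent G A & independent G B].

(* The default value #|T| exceeds every degree, so it plays no role when A is
   nonempty. *)
Definition min_degree_in (G : sgraph) (A : {set T}) : nat :=
  \big[minn/#|T|]_(x in A) degree G x.

Definition vertex_cover (G : sgraph) (C : {set T}) : bool :=
  [forall x, forall y, adj G x y ==> (x \in C) || (y \in C)].

(* The default value #|T| is the size of the cover setT. *)
Definition cover_number (G : sgraph) : nat :=
  \big[minn/#|T|]_(C : {set T} | vertex_cover G C) #|C|.

Definition connected_graph (G : sgraph) : Prop :=
  forall x y, connect (adj G) x y.

Definition acyclic_graph (G : sgraph) : Prop :=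
  forall s : seq T, (2 < size s)%N -> ~~ ucycleb (adj G) s.

Definition is_tree (G : sgraph) : Prop :=
  (0 < #|T|)%N /\ connected_graph G /\ acyclic_graph G.

End SimpleGraph.

(* Containment as a not necessarily induced subgraph. *)
Definition contains_copy (S T : finType) (F : sgraph S) (G : sgraph T) : bool :=
  [exists f : {ffun S -> T},
    injectiveb f && [forall x, forall y, adj F x y ==> adj G (f x) (f y)]].

Definition is_free (S T : finType) (F : sgraph S) (G : sgraph T) : bool :=
  ~~ contains_copy F G.

Definition isomorphic (S T : finType) (G : sgraph S) (H : sgraph T) : Prop :=
  exists2 f : S -> T, bijective f & forall x y, adj G x y = adj H (f x) (f y).

Section JoinGraph.
Variables n k p : nat.

(* Vertices below k form the clique; the q-th added edge, for q < p, joins the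
   vertices k + 2q and k + 2q + 1. *)
Definition S_rel (i j : 'I_n) : bool :=
  (i != j) &&
  [|| (i < k)%N, (j < k)%N | ((i - k)./2 == (j - k)./2) && ((i - k)./2 < p)%N].

Definition S_arcs : {set 'I_n * 'I_n} := [set e | S_rel e.1 e.2].

Fact S_arcs_simple : simple_adj S_arcs.
Proof.
apply/forallP=> i; apply/forallP=> j; apply/implyP; rewrite !inE /S_rel /=.
case/andP=> nij H; rewrite nij eq_sym nij /=.
case/or3P: H => [-> | -> | /andP[/eqP-> ->]]; by rewrite ?eqxx ?orbT.
Qed.

(* S_{n,k}^p; meaningful for 0 < k < n and p <= (n - k) / 2. *)
Definition S_graph : sgraph 'I_n := SGraph S_arcs_simple.

End JoinGraph.

Section Spectral.
Variable R : realType.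
Local Open Scope ring_scope.

Definition adjmx (n : nat) (G : sgraph 'I_n) : 'M[R]_n :=
  \matrix_(i, j) (adj G i j)%:R.

(* All complex roots of the characteristic polynomial. *)
Definition eigenvalues (n : nat) (A : 'M[R]_n) : seq R[i] :=
  sval (closed_field_poly_normal (char_poly (map_mx (real_complex R) A))).

Definition spectral_radius (n : nat) (A : 'M[R]_n) : R :=
  \big[Num.max/0]_(z <- eigenvalues A) Normc.normc z.

Definition rho (n : nat) (G : sgraph 'I_n) : R := spectral_radius (adjmx G).

Definition spex (T : finType) (n : nat) (F : sgraph T) : R :=
  \big[Num.max/0]_(G : sgraph 'I_n | is_free F G) rho G.

(* All labelled copies on 'I_n of the extremal graphs. *)
Definition SPEX (T : finType) (n : nat) (F : sgraph T) (G : sgraph 'I_n) : Prop :=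
  is_free F G /\ rho G = spex n F.

(* SPEX(n,F) = {H}, graphs being identified up to isomorphism. *)
Definition SPEX_is (T : finType) (n : nat) (F : sgraph T) (H : sgraph 'I_n) :
    Prop :=
  forall G : sgraph 'I_n, SPEX F G <-> isomorphic G H.

End Spectral.

(* Main.v *)
(* A graph [G] whose spectral radius [r] is at least that of [S_{n,k}^p], and
   which contains no copy of the tree [F], is sparse: its edges can be oriented
   with bounded out-degrees.  In the Rayleigh quotient of a Perron vector [x] the
   edges between vertices of small degree are then negligible, and since no
   [k+1] vertices have many common neighbors, the remaining edges can account
   for [r >= sqrt (k (n - k))] only if some set [L] of exactly [k] vertices is
   joined to almost all others.  Let [R0] be the set of common neighbors of [L]
   and [E] the set of the remaining vertices.  An embedding argument shows that
   every vertex outside [L] has at most one neighbor in [R0], and that [R0]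
   spans at most [p] edges.  The entries of [x] are small outside [L] and bounded
   below on [L], so replacing the edges at [E] outside [L] by the missing edges
   between [E] and [L] increases the Rayleigh quotient and produces a subgraph
   of [S_{n,k}^p]; hence [E] is empty and [G] is [S_{n,k}^p].

   When [F] has odd order and all its vertices in [A] have degree at least 2,
   counting edges shows that these degrees are exactly 2, i.e. [F] is the
   subdivision of a tree on [B]. *)
Require Import Defs.
From HB Require Import structures.
From mathcomp Require Import all_boot all_order all_algebra.
From mathcomp Require Import reals complex.
From mathcomp Require Import spectral ring lra zify.

Set Implicit Arguments.
Unset Strict Implicit.
Unset Printing Implicit Defensive.

Import Order.TTheory GRing.Theory Num.Theory.

(** * Rayleigh quotients and Perron vectors *)

Section Rayleigh.
Variable R : realType.
Local Open Scope ring_scope.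
Local Open Scope sesquilinear_scope.

(** The graph [G] need not be connected, so its nonnegative eigenvector, built from the moduli of a
    complex one, may have zero entries. Positivity is recovered only at the end: equality in the
    comparison turns the transported vector into an eigenvector of [S_graph n k p], where a vertex
    adjacent to all others forces every entry to be positive. Uniqueness is proved under a weak
    inequality between spectral radii, which yields both the value of [spex] and all graphs
    attaining it. The eigenvector is used in two normalizations: Euclidean norm 1 to locate [L],
    where only sums of squares matter, and maximum 1 in the comparison, where single entries are
    bounded. The constants are chosen in the order [delta], [eps], [tau], from the order of the tree
    alone, so that the threshold on [n] is uniform in the tree. The converse implications come from
    copies inside [S_graph n k p] itself: a cover of at most [k] vertices fits into the clique, and
    for [p = 1] a leaf in [A] is absorbed by the extra edge. *)

Lemma root_in_eigenvalues n (A : 'M[R]_n) (z : R[i]) :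
  (z \in eigenvalues A) = root (char_poly (map_mx (real_complex R) A)) z.
Proof.
rewrite /eigenvalues; case: closed_field_poly_normal => r /= ->.
by rewrite (monicP (char_poly_monic _)) scale1r root_prod_XsubC.
Qed.

Lemma normc_eigenvalue_le n (A : 'M[R]_n) (z : R[i]) :
  eigenvalue (map_mx (real_complex R) A) z ->
  Normc.normc z <= spectral_radius A.
Proof.
rewrite eigenvalue_root_char -root_in_eigenvalues => zA.
exact: le_bigmax_seq zA isT.
Qed.

Lemma spectral_radius_ge0 n (A : 'M[R]_n) : 0 <= spectral_radius A.
Proof. exact: bigmax_ge_id. Qed.

Lemma spectral_radius_attained n (A : 'M[R]_n) : (0 < n)%N ->
  exists2 z : R[i], eigenvalue (map_mx (real_complex R) A) z &
    Normc.normc z = spectral_radius A.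
Proof.
move=> n_gt0; have [z0 ez0] := eigenvalue_closed (map_mx (real_complex R) A) n_gt0.
have: z0 \in eigenvalues A by rewrite root_in_eigenvalues -eigenvalue_root_char.
have: forall z, z \in eigenvalues A -> eigenvalue (map_mx (real_complex R) A) z.
  by move=> z; rewrite root_in_eigenvalues -eigenvalue_root_char.
rewrite /spectral_radius; elim: (eigenvalues A) z0 {ez0} => // z s IHs z0 Hs _.
rewrite big_cons; case: s IHs Hs => [|z1 s] IHs Hs.
  exists z; first by apply: Hs; rewrite mem_head.
  rewrite big_nil; apply/esym/max_idPl; case: (z) => a b; exact: sqrtr_ge0.
have [|z2 ez2 e2] := IHs z1 _ (mem_head _ _).
  by move=> z' z's; apply: Hs; rewrite inE z's orbT.
rewrite -e2; have [_|_] := leP (Normc.normc z2) (Normc.normc z).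
  exists z; first by apply: Hs; rewrite mem_head.
  reflexivity.
by exists z2.
Qed.

Definition qform n (a : 'I_n -> 'I_n -> R) (x : 'I_n -> R) : R :=
  \sum_i \sum_j a i j * x i * x j.

(** The complexified matrix is normal, hence unitarily diagonalizable. In the coordinates [w] the
    form is a combination of the eigenvalues with weights [|w_i|^2], and each eigenvalue has modulus
    at most the spectral radius. *)
Lemma Rayleigh_le n (A : 'M[R]_n) (x : 'I_n -> R) :
  (forall i j, A i j = A j i) ->
  qform A x <= spectral_radius A * \sum_i x i ^+ 2.
Proof.
move=> symA.
set AC := map_mx (real_complex R) A.
have AC_normal : AC \is normalmx.
  apply: symmetric_normalmx; last first.
    by apply/mxOverP => i j; rewrite mxE; apply/complex_realP; exists (A i j).
  apply/is_hermitianmxP; rewrite expr0 scale1r; apply/matrixP => i j.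
  by rewrite !mxE symA.
have := orthomx_spectralP AC_normal.
set P := spectralmx AC; set sp := spectral_diag AC => dAC.
have PU : P \is unitarymx := spectral_unitarymx AC.
have Punit := unitarymx_unit PU.
have sp_le i : `|sp 0 i| <= (spectral_radius A)%:C%C.
  rewrite -[`|_|]/((Normc.normc (sp 0 i))%:C%C) lecR.
  apply: normc_eigenvalue_le.
  apply/eigenvalueP; exists (row i P).
    rewrite -row_mul -[map_mx _ _]/AC dAC !mulmxA mulmxV // mul1mx.
    by rewrite row_mul row_diag_mx -scalemxAl -rowE.
  apply/eqP => rowi0.
  have: row i (P *m invmx P) = 0 by rewrite row_mul rowi0 mul0mx.
  move/rowP/(_ i); rewrite mulmxV // !mxE eqxx => /eqP.
  by rewrite oner_eq0.
pose v : 'rV[R[i]]_n := \row_i (x i)%:C%C.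
pose w := v *m P ^t*.
have vtE : v ^t* = v^T.
  by apply/matrixP => i j; rewrite !mxE; apply: conjc_real.
have e1 : (v *m AC *m v ^t*) 0 0 = \sum_i sp 0 i * `|w 0 i| ^+ 2.
  have -> : v *m AC *m v ^t* = w *m diag_mx sp *m w ^t*.
    by rewrite dAC invmx_unitary // /w trmx_mul map_mxM /= trmxCK !mulmxA.
  rewrite mxE; apply: eq_bigr => i _.
  rewrite mul_mx_diag !mxE normCK.
  by rewrite mulrAC mulrC.
have e2 : (v *m v ^t*) 0 0 = \sum_i `|w 0 i| ^+ 2.
  have -> : v *m v ^t* = w *m w ^t*.
    rewrite /w trmx_mul map_mxM /= trmxCK -!mulmxA.
    by rewrite (mulmxA _ P) -invmx_unitary // mulVmx // mul1mx.
  by rewrite mxE; apply: eq_bigr => i _; rewrite !mxE normCK.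
have e3 : (v *m AC *m v ^t*) 0 0 = (qform A x)%:C%C.
  rewrite vtE mxE /qform exchange_big /= rmorph_sum /=; apply: eq_bigr => j _.
  rewrite !mxE mulr_suml rmorph_sum /=; apply: eq_bigr => i _.
  rewrite !mxE !rmorphM /=; congr (_ * _); exact: mulrC.
have e4 : (v *m v ^t*) 0 0 = (\sum_i x i ^+ 2)%:C%C.
  rewrite vtE mxE rmorph_sum /=; apply: eq_bigr => j _.
  by rewrite !mxE rmorphXn /= expr2.
rewrite -lecR rmorphM /= -e3 -e4 e1 e2.
apply: le_trans (_ : `|\sum_i sp 0 i * `|w 0 i| ^+ 2| <= _).
  by apply: real_ler_norm; rewrite -e1 e3; apply/complex_realP; exists (qform A x).
apply: le_trans (ler_norm_sum _ _ _) _.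
rewrite mulr_sumr; apply: ler_sum => i _.
rewrite normrM (ger0_norm (exprn_ge0 _ (normr_ge0 _))).
by apply: ler_wpM2r; rewrite ?exprn_ge0.
Qed.

(** A maximizer of the Rayleigh quotient is an eigenvector. Moving [x] against the residual
    [y = r x - A x] changes the defect at first order by [-2 t N] with [N = |y|^2], and at second
    order by [t^2 Q]; the step [t = N / Q] makes it negative unless [N = 0]. *)
Lemma Rayleigh_eq n (A : 'M[R]_n) (x : 'I_n -> R) :
  (forall i j, A i j = A j i) ->
  spectral_radius A * (\sum_i x i ^+ 2) <= qform A x ->
  forall i, \sum_j A i j * x j = spectral_radius A * x i.
Proof.
move=> symA ge_x; set r := spectral_radius A in ge_x *.
pose y i := r * x i - \sum_j A i j * x j.
pose N := \sum_i y i ^+ 2.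
pose Q := r * (\sum_i y i ^+ 2) - qform A y.
have key (t : R) : 0 <= t -> 2 * t * N <= t ^+ 2 * Q.
  move=> t_ge0; have := Rayleigh_le (fun i => x i - t * y i) symA.
  rewrite -/r.
  have -> : qform A (fun i => x i - t * y i) =
     qform A x - 2 * t * (\sum_i y i * (\sum_j A i j * x j)) + t ^+ 2 * qform A y.
    have h : qform A (fun i => x i - t * y i) = qform A x
       - t * (\sum_i \sum_j A i j * x j * y i)
       - t * (\sum_i \sum_j A i j * x i * y j) + t ^+ 2 * qform A y.
      rewrite /qform !mulr_sumr -!sumrB -big_split /=; apply: eq_bigr => i _.
      rewrite !mulr_sumr -!sumrB -big_split /=; apply: eq_bigr => j _.
      ring.
    rewrite h; have -> : \sum_i \sum_j A i j * x i * y j =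
        \sum_i \sum_j A i j * x j * y i.
      rewrite exchange_big /=; apply: eq_bigr => i _; apply: eq_bigr => j _.
      by rewrite symA.
    have -> : \sum_i y i * (\sum_j A i j * x j) = \sum_i \sum_j A i j * x j * y i.
      by apply: eq_bigr => i _; rewrite mulrC mulr_suml.
    ring.
  have -> : \sum_i (x i - t * y i) ^+ 2 =
     \sum_i x i ^+ 2 - 2 * t * (\sum_i y i * x i) + t ^+ 2 * \sum_i y i ^+ 2.
    rewrite !mulr_sumr -sumrB -big_split /=; apply: eq_bigr => i _; ring.
  have N_E : N = r * (\sum_i y i * x i) - \sum_i y i * (\sum_j A i j * x j).
    rewrite /N mulr_sumr -sumrB; apply: eq_bigr => i _.
    rewrite expr2 -[X in _ * X]/(r * x i - \sum_j A i j * x j); ring.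
  rewrite /Q; move: N_E ge_x.
  move: (\sum_i y i * x i) (\sum_i y i * _) (\sum_i x i ^+ 2) (\sum_i y i ^+ 2)
    (qform A x) (qform A y) => a b c d e f -> ge_x.
  move=> h; lra.
have N_ge0 : 0 <= N by apply: sumr_ge0 => i _; apply: sqr_ge0.
have N0 : N = 0.
  apply/eqP; rewrite eq_le N_ge0 andbT leNgt; apply/negP => N_gt0.
  have [Q_le0|Q_gt0] := leP Q 0.
    by have := key 1 ler01; lra.
  have := key (N / Q) (divr_ge0 N_ge0 (ltW Q_gt0)).
  have -> : (N / Q) ^+ 2 * Q = (N / Q) * N by field; lra.
  have : 0 < N / Q * N by rewrite mulr_gt0 ?divr_gt0.
  lra.
move=> i; have := psumr_eq0P (fun i _ => sqr_ge0 (y i)) N0 (i := i) isT.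
by move/eqP; rewrite sqrf_eq0 subr_eq0 => /eqP.
Qed.

(** Take a complex eigenvector whose eigenvalue has maximal modulus. By the triangle inequality the
    moduli of its entries attain the Rayleigh bound, so they form an eigenvector. *)
Lemma Perron_vector n (A : 'M[R]_n) : (0 < n)%N ->
  (forall i j, A i j = A j i) -> (forall i j, 0 <= A i j) ->
  exists x : 'I_n -> R, [/\ forall i, 0 <= x i, exists i, 0 < x i &
    forall i, \sum_j A i j * x j = spectral_radius A * x i].
Proof.
move=> n_gt0 symA A_ge0.
have [z ez rz] := spectral_radius_attained A n_gt0.
have /eigenvalueP[v vA v0] := ez.
pose nc (u : R[i]) := Normc.normc u.
have nc_ge0 u : 0 <= nc u by case: u => a b; exact: sqrtr_ge0.
have nc_sum (I : finType) (f : I -> R[i]) : nc (\sum_i f i) <= \sum_i nc (f i).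
  elim/big_rec2: _ => [|i y1 y2 _ le12]; first by rewrite /nc Normc.normc0.
  by apply: le_trans (le_normcD _ _) _; rewrite lerD2l.
have nc_real (a : R) : 0 <= a -> nc a%:C%C = a.
  by move=> a_ge0; rewrite /nc /= expr0n /= addr0 sqrtr_sqr ger0_norm.
exists (fun i => nc (v 0 i)); split => //.
  have /rV0Pn[i vi] := v0; exists i; rewrite lt_def nc_ge0 andbT.
  by apply: contra vi => /eqP/Normc.eq0_normc ->.
apply: Rayleigh_eq => //; rewrite mulr_sumr /qform; apply: ler_sum => i _.
have -> : \sum_j A i j * nc (v 0 i) * nc (v 0 j) =
    nc (v 0 i) * \sum_j A i j * nc (v 0 j).
  by rewrite mulr_sumr; apply: eq_bigr => j _; ring.
rewrite expr2 mulrCA; apply: ler_wpM2l => //.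
rewrite -rz -[_ * _]Normc.normcM -/(nc _).
have -> : z * v 0 i = \sum_j v 0 j * (A j i)%:C%C.
  by have /rowP/(_ i) := vA; rewrite !mxE => <-; apply: eq_bigr => j _; rewrite mxE.
apply: le_trans (nc_sum _ _) _; apply: ler_sum => j _.
by rewrite /nc Normc.normcM -/(nc _) -/(nc _) nc_real // mulrC symA.
Qed.

End Rayleigh.

(** * Trees *)

Section GraphBasics.
Variables (T : finType) (G : sgraph T).

Lemma adj_sym : symmetric (adj G).
Proof.
have h x y : adj G x y -> adj G y x.
  move=> xy; have /forallP/(_ x)/forallP/(_ y) := valP G.
  by rewrite -[_ \in val G]/(adj G x y) xy => /andP[].
by move=> x y; apply/idP/idP; apply: h.
Qed.

Lemma adj_irr x : adj G x x = false.
Proof.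
apply/negP => xx; have /forallP/(_ x)/forallP/(_ x) := valP G.
by rewrite -[_ \in val G]/(adj G x x) xx eqxx.
Qed.

Lemma adj_neq x y : adj G x y -> x != y.
Proof. by apply: contraL => /eqP->; rewrite adj_irr. Qed.

End GraphBasics.

Section Tree.
Variables (T : finType) (F : sgraph T).
Hypothesis treeF : is_tree F.

(** Induction by growing a connected set from [v0], one vertex at a time. It replaces the removal of
    leaves, and keeps the ambient type fixed. *)
Lemma tree_ind (v0 : T) (Q : {set T} -> Prop) :
  Q [set v0] ->
  (forall (P : {set T}) (w p : T), v0 \in P -> w \notin P -> p \in P ->
     adj F w p -> {in P, forall p', adj F w p' -> p' = p} ->
     Q P -> Q (w |: P)) ->
  Q setT.
Proof.
move=> Q0 QS; have [_ [conF acyF]] := treeF.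
pose e (P : {set T}) : rel T := fun x y => [&& adj F x y, x \in P & y \in P].
have main m : (m < #|T|)%N -> exists P : {set T}, [/\ #|P| = m.+1, v0 \in P,
    {in P &, forall x y, connect (e P) x y} & Q P].
  elim: m => [_|m IHm m_lt].
    exists [set v0]; rewrite cards1 set11; split => //.
    by move=> x y /set1P-> /set1P->.
  have [P [cP v0P conP QP]] := IHm (ltnW m_lt).
  have [z zP] : exists z, z \notin P.
    apply/existsP; rewrite -negb_forall; apply/negP => /forallP allP.
    have : setT \subset P by apply/subsetP => z _; apply: allP.
    by move/subset_leq_card; rewrite cardsT cP leqNgt m_lt.
  have [p [w [pP wP pw]]] : exists p w, [/\ p \in P, w \notin P & adj F p w].
    have /connectP[s] := conF v0 z.
    elim: s (v0) v0P => [|y s IHs] x xP /=.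
      by move=> _ zx; rewrite zx xP in zP.
    case/andP=> xy sy zE; have [yP|yP] := boolP (y \in P).
      exact: IHs yP sy zE.
    by exists x, y.
  (* A second neighbor [p'] of [w] in [P] would close a cycle through [w] with a simple path from
     [p] to [p'] inside [P]. *)
  have uniq_p : {in P, forall p', adj F w p' -> p' = p}.
    move=> p' p'P wp'; apply/eqP; apply/negPn/negP => p'p.
    have /connectP[s0 s0P] := conP _ _ pP p'P.
    case/shortenP: s0P => s sP us _ p'E {s0}.
    have sub_s : {subset p :: s <= P}.
      move=> y; rewrite inE => /predU1P[->//|].
      elim: s (p) sP {us p'E} => //= y' s IHs q /andP[/and3P[_ _ y'P] sP].
      by rewrite inE => /predU1P[->//|]; apply: IHs sP.
    have s_nil : s != [::].
      by apply: contraNneq p'p => s0; rewrite p'E s0.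
    have sz : (2 < size (w :: p :: s))%N by case: (s) s_nil.
    have /negP := acyF _ sz; case; rewrite /ucycleb cons_uniq us.
    rewrite (contra (sub_s w) wP) !andbT /= rcons_path -p'E adj_sym pw /=.
    rewrite [adj F p' w]adj_sym wp' andbT.
    by apply: sub_path sP => x y /and3P[].
  exists (w |: P); rewrite cardsU1 wP cP inE v0P orbT; split => //.
    have mono : subrel (e P) (e (w |: P)).
      by move=> x y /and3P[xy xP yP]; rewrite /e xy !inE xP yP !orbT.
    have pw1 : connect (e (w |: P)) p w.
      by apply: connect1; rewrite /e pw !inE pP eqxx orbT.
    have wp1 : connect (e (w |: P)) w p.
      by apply: connect1; rewrite /e adj_sym pw !inE pP eqxx orbT.
    have up x y : x \in P -> y \in P -> connect (e (w |: P)) x y.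
      move=> xP yP; apply: connect_sub (conP x y xP yP) => x' y' xy.
      exact/connect1/mono.
    move=> x y; rewrite !inE => /predU1P[->|xP] /predU1P[->|yP] //.
    - by apply: connect_trans wp1 _; apply: up.
    - by apply: connect_trans pw1; apply: up.
    - exact: up.
  by apply: (QS P w p) QP => //; rewrite adj_sym.
have T_gt0 : (0 < #|T|)%N by have [] := treeF.
have [|P [cP _ _ QP]] := main #|T|.-1; first by rewrite prednK.
have <- // : P = setT.
by apply/eqP; rewrite eqEcard subsetT cardsT cP prednK ?leqnn.
Qed.

(** The rank [r] is the time of insertion in [tree_ind]. It orders the tree so that ancestors come
    first, which later rules out unwanted coincidences between vertices. *)
Lemma tree_parent (v0 : T) : exists (par : T -> T) (r : T -> nat),
  (forall v, v != v0 -> adj F v (par v) /\ (r (par v) < r v)%N) /\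
  (forall u v, adj F u v -> u != v0 /\ par u = v \/ v != v0 /\ par v = u).
Proof.
pose Q (P : {set T}) := exists (par : T -> T) (r : T -> nat),
  [/\ {in P, forall v, v != v0 -> [/\ par v \in P, adj F v (par v) &
         (r (par v) < r v)%N]},
      {in P &, forall u v, adj F u v ->
         u != v0 /\ par u = v \/ v != v0 /\ par v = u}
    & {in P, forall v, r v < #|P|}%N].
suff [par [r [h1 h2 _]]] : Q setT.
  exists par, r; split => [v vv0|u v uv]; last exact: h2.
  by have [] := h1 v (in_setT _) vv0.
apply: (tree_ind (v0 := v0) (Q := Q)).
  exists id, (fun=> 0%N); rewrite cards1; split => //.
    by move=> v /set1P->; rewrite eqxx.
  by move=> u v /set1P-> /set1P->; rewrite adj_irr.
move=> P w p v0P wP pP wp up [par [r [h1 h2 h3]]].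
have wv0 : w != v0 by apply: contraNneq wP => ->.
have nw v : v \in P -> (v == w) = false.
  by move=> vP; apply: contraNF wP => /eqP<-.
exists (fun v => if v == w then p else par v),
       (fun v => if v == w then #|P| else r v); split.
- move=> v; rewrite !inE => /predU1P[->|vP] vv0.
    by rewrite eqxx pP orbT wp nw // h3.
  have [q1 q2 q3] := h1 v vP vv0.
  by rewrite nw // nw // !inE q1 orbT; split.
- move=> u v; rewrite !inE => /predU1P[->|uP] /predU1P[->|vP].
  + by rewrite adj_irr.
  + by move/(up v vP)=> ->; left; rewrite eqxx.
  + by rewrite adj_sym => /(up u uP)->; right; rewrite eqxx.
  + by rewrite !nw //; apply: h2.
- move=> v; rewrite cardsU1 wP !inE => /predU1P[->|vP]; first by rewrite eqxx.
  by rewrite nw // add1n ltnS ltnW ?h3.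
Qed.

(** Greedy embedding: fewer than [#|T|] vertices are occupied at each stage, so the image of the
    parent has a free neighbor in [U]. *)
Lemma tree_embedding (V : finType) (G : sgraph V) (U : {set V}) (u0 : V) :
  u0 \in U -> {in U, forall u, #|T| <= #|[set v in U | adj G u v]|}%N ->
  contains_copy F G.
Proof.
move=> u0U degU; have [T_gt0 _] := treeF.
have /card_gt0P[v0 _] := T_gt0.
pose Q (P : {set T}) := exists f : T -> V, [/\ {in P, forall t, f t \in U},
    {in P &, injective f} & {in P &, forall s t, adj F s t -> adj G (f s) (f t)}].
suff [f [h1 h2 h3]] : Q setT.
  apply/existsP; exists [ffun t => f t]; apply/andP; split.
    by apply/injectiveP => s t; rewrite !ffunE; apply: h2; rewrite inE.
  apply/forallP => s; apply/forallP => t; apply/implyP; rewrite !ffunE.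
  by apply: h3; rewrite inE.
apply: (tree_ind (v0 := v0) (Q := Q)).
  exists (fun=> u0); split => //.
    by move=> s t /set1P-> /set1P->.
  by move=> s t /set1P-> /set1P->; rewrite adj_irr.
move=> P w p v0P wP pP wp up [f [h1 h2 h3]].
have [u /setDP[]] : exists u, u \in [set v in U | adj G (f p) v] :\: f @: P.
  apply/set0Pn; rewrite -card_gt0 cardsD subn_gt0.
  apply: leq_ltn_trans (_ : (#|P| < _)%N).
    by apply: leq_trans (leq_imset_card f P); apply: subset_leq_card; apply: subsetIr.
  apply: leq_trans (degU _ (h1 p pP)); rewrite -cardsT.
  by apply: proper_card; rewrite properE subsetT; apply/subsetPn; exists w; rewrite ?inE.
rewrite inE => /andP[uU pu] uf.
have nw v : v \in P -> (v == w) = false.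
  by move=> vP; apply: contraNF wP => /eqP<-.
have nu v : v \in P -> f v != u.
  by move=> vP; apply: contraNneq uf => <-; apply: imset_f.
exists (fun v => if v == w then u else f v); split.
- by move=> v; rewrite !inE => /predU1P[->|vP]; rewrite ?eqxx // nw ?h1.
- move=> s t; rewrite !inE => /predU1P[->|sP] /predU1P[->|tP] //.
  + by rewrite eqxx nw // => /esym/eqP; rewrite (negPf (nu t tP)).
  + by rewrite eqxx nw // => /eqP; rewrite (negPf (nu s sP)).
  + by rewrite !nw //; apply: h2.
- move=> s t; rewrite !inE => /predU1P[->|sP] /predU1P[->|tP].
  + by rewrite adj_irr.
  + by move/(up t tP)=> ->; rewrite eqxx nw // adj_sym.
  + by rewrite adj_sym => /(up s sP)->; rewrite eqxx nw.
  + by rewrite !nw //; apply: h3.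
Qed.

End Tree.

(** * Orientations with bounded out-degrees *)

Section Orientation.
Variables (V : finType) (G : sgraph V).

(** Vertices of degree at most [d] in the remaining graph are removed one by one, and the edges
    still present at a removed vertex are oriented away from it. The equation in [nat] says that
    each edge receives exactly one direction. *)
Lemma degenerate_orientation d :
  (forall U : {set V}, U != set0 ->
     exists2 u, u \in U & #|[set v in U | adj G u v]| <= d)%N ->
  exists o : rel V, (forall u v, (adj G u v = o u v + o v u :> nat)%N) /\
    (forall u, #|[set v | o u v]| <= d)%N.
Proof.
move=> degU.
suff main m (U : {set V}) : #|U| = m -> exists o : rel V,
    {in U &, forall u v, (adj G u v = o u v + o v u :> nat)%N} /\
    {in U, forall u, #|[set v in U | o u v]| <= d}%N.
  have [o [o1 o2]] := main _ setT erefl; exists o; split => [u v|u].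
    exact: o1.
  apply: leq_trans (o2 u (in_setT _)); apply: subset_leq_card.
  by apply/subsetP => v; rewrite !inE.
elim: m U => [|m IHm] U cU.
  exists (fun _ _ => false); move/eqP: cU; rewrite cards_eq0 => /eqP->.
  by split=> [u v|u]; rewrite inE.
have [|u uU du] := degU U; first by rewrite -card_gt0 cU.
have [|o [o1 o2]] := IHm (U :\ u); first by rewrite (cardsD1 u) uU in cU; case: cU.
exists (fun a b => if a == u then adj G a b else if b == u then false else o a b).
split.
  move=> a b aU bU; have [->|au] := eqVneq a u; have [->|bu] := eqVneq b u.
  - by rewrite adj_irr.
  - by rewrite addn0.
  - by rewrite adj_sym.
  - by apply: o1; rewrite !inE ?au ?bu.
move=> a aU; have [->|au] := eqVneq a u; first exact: du.
apply: leq_trans (o2 a _); last by rewrite !inE au.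
apply: subset_leq_card; apply/subsetP => b; rewrite !inE => /andP[->].
by case: eqP.
Qed.

Lemma tree_free_orientation (T : finType) (F : sgraph T) :
  is_tree F -> is_free F G ->
  exists o : rel V, (forall u v, (adj G u v = o u v + o v u :> nat)%N) /\
    (forall u, #|[set v | o u v]| <= #|T|)%N.
Proof.
move=> treeF freeG; apply: degenerate_orientation => U /set0Pn[u0 u0U].
have [/existsP[u /andP[uU du]]|] :=
  boolP [exists u, (u \in U) && (#|[set v in U | adj G u v]| <= #|T|)%N].
  by exists u.
rewrite negb_exists => /forallP allU; case/negP: freeG.
apply: (tree_embedding treeF u0U) => u uU.
by have := allU u; rewrite uU /= -ltnNge => /ltnW.
Qed.

End Orientation.

Lemma card_injection (S V : finType) (X : {set S}) (Y : {set V}) (y0 : V) :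
  (#|X| <= #|Y|)%N ->
  exists i : S -> V, {in X, forall x, i x \in Y} /\ {in X &, injective i}.
Proof.
move=> XY; exists (fun x => nth y0 (enum Y) (index x (enum X))).
have lt x : x \in X -> (index x (enum X) < size (enum Y))%N.
  move=> xX; rewrite -cardE; apply: leq_trans XY.
  by rewrite cardE index_mem mem_enum.
split=> [x xX|x y xX yX /eqP].
  by rewrite -mem_enum mem_nth ?lt.
rewrite nth_uniq ?lt ?enum_uniq // => /eqP e.
have xE : x \in enum X by rewrite mem_enum.
have yE : y \in enum X by rewrite mem_enum.
by rewrite -(nth_index x xE) e nth_index.
Qed.

(** * Embeddings along a nearly complete bipartite graph *)

Section Embedding.
Variables (T V : finType) (F : sgraph T) (G : sgraph V).

(* [C] is mapped into [L], [D] by the prescribed map [g], all the other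
   vertices into [R]. *)
Lemma embedding_lemma (L R : {set V}) (C D : {set T}) (g : T -> V) :
  [disjoint L & R] ->
  {in L & R, forall u v, adj G u v} ->
  (#|C| <= #|L|)%N -> (#|T|.*2 <= #|R|)%N ->
  {in C &, forall s t, adj F s t -> {in L &, forall u v, u != v -> adj G u v}} ->
  {in D &, injective g} -> {in D, forall t, g t \notin L} ->
  {in D & C, forall s t, adj F s t -> g s \in R} ->
  {in D &, forall s t, adj F s t -> adj G (g s) (g t)} ->
  (forall s t, adj F s t -> s \notin C -> t \notin C -> s \in D /\ t \in D) ->
  contains_copy F G.
Proof.
move=> LR adjLR CL TR adjC injg gL gR adjD edgeD.
have [T0|] := posnP #|T|.
  have noT (t : T) : False by have := max_card (pred1 t); rewrite T0 card1.
  apply/existsP; exists (finfun (fun t : T => False_rect V (noT t))).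
  apply/andP; split; first by apply/injectiveP => t; case: (noT t).
  by apply/forallP => t; case: (noT t).
case/card_gt0P=> t0 _.
have [v0 _] : exists v0, v0 \in R.
  apply/card_gt0P; apply: leq_trans TR; rewrite double_gt0.
  by apply/card_gt0P; exists t0.
have [iL [iL1 iL2]] := card_injection v0 CL.
(* The factor two in the bound on [R] is spent here: [g] occupies at most [#|T|] vertices, and
   [#|T|] others remain. *)
have [|iR [iR1 iR2]] := @card_injection _ _ [set: T] (R :\: g @: D) v0.
  rewrite cardsT cardsD leq_subRL.
    apply: leq_trans TR; rewrite -addnn leq_add2r.
    apply: leq_trans (subset_leq_card (subsetIr _ _)) _.
    by apply: leq_trans (leq_imset_card _ _) (max_card _).
  exact/subset_leq_card/subsetIl.
have iRR t : iR t \in R by have := iR1 t (in_setT t); rewrite inE => /andP[].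
have iRD s t : s \in D -> iR t != g s.
  move=> sD; have := iR1 t (in_setT t); rewrite inE => /andP[+ _].
  by apply: contraNneq => ->; apply: imset_f.
have nLR u v : u \in L -> v \in R -> u != v.
  by move=> uL vR; apply: contraTneq uL => ->; rewrite (disjointFl LR).
pose f t := if t \in C then iL t else if t \in D then g t else iR t.
have injf : injective f.
  move=> s t; rewrite /f.
  have [sC|sC] := boolP (s \in C); have [tC|tC] := boolP (t \in C).
  - exact: iL2.
  - case: ifPn => [tD|tD] /eqP; last by rewrite (negPf (nLR _ _ (iL1 s sC) (iRR t))).
    by move/eqP=> e; have := gL t tD; rewrite -e iL1.
  - case: ifPn => [sD|sD] /eqP; last first.
      by rewrite eq_sym (negPf (nLR _ _ (iL1 t tC) (iRR s))).
    by move/eqP=> e; have := gL s sD; rewrite e iL1.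
  - have [sD|sD] := boolP (s \in D); have [tD|tD] := boolP (t \in D).
    + exact: injg.
    + by move/eqP; rewrite eq_sym (negPf (iRD _ _ sD)).
    + by move/eqP; rewrite (negPf (iRD _ _ tD)).
    + by apply: iR2; rewrite inE.
have adjf1 s t : s \in C -> adj F s t -> adj G (f s) (f t).
  move=> sC st; rewrite /f sC; case: ifPn => tC.
    apply: (adjC s t) => //; rewrite ?iL1 //.
    apply: contraTneq st => /(iL2 _ _ sC tC)->; by rewrite adj_irr.
  apply: adjLR; first exact: iL1.
  by case: ifPn => [tD|//]; apply: (gR t s) => //; rewrite adj_sym.
apply/existsP; exists (finfun f); apply/andP; split.
  by apply/injectiveP => s t; rewrite !ffunE; apply: injf.
apply/forallP => s; apply/forallP => t; apply/implyP => st; rewrite !ffunE.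
have [sC|sC] := boolP (s \in C); first exact: adjf1.
have [tC|tC] := boolP (t \in C); first by rewrite adj_sym adjf1 // adj_sym.
have [sD tD] := edgeD s t st sC tC.
by rewrite /f (negPf sC) (negPf tC) sD tD; apply: adjD.
Qed.

End Embedding.

(** * Vertex covers *)

Lemma leq_bigminn (I : finType) (P : pred I) (f : I -> nat) N m :
  (m <= \big[minn/N]_(i | P i) f i)%N <->
  (m <= N)%N /\ (forall i, P i -> m <= f i)%N.
Proof.
have h (s : seq I) : (m <= \big[minn/N]_(i <- s | P i) f i)%N <->
    (m <= N)%N /\ (forall i, i \in s -> P i -> m <= f i)%N.
  elim: s => [|i s [IH1 IH2]]; first by rewrite big_nil; split=> // -[].
  rewrite big_cons; split.
    case: ifPn => [Pi|Pi].
      rewrite leq_min => /andP[mi /IH1[mN ms]]; split => // j.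
      by rewrite inE => /predU1P[->//|]; apply: ms.
    move=> /IH1[mN ms]; split=> // j; rewrite inE => /predU1P[->|]; last exact: ms.
    by rewrite (negPf Pi).
  case=> mN ms.
  have IH : (m <= \big[minn/N]_(i <- s | P i) f i)%N.
    by apply: IH2; split=> // j js; apply: ms; rewrite inE js orbT.
  by case: ifPn => // Pi; rewrite leq_min IH ms ?mem_head.
case: (h (index_enum I)) => h1 h2; split.
  by move/h1=> [mN ms]; split=> // i; apply: ms; rewrite mem_index_enum.
by case=> mN ms; apply: h2; split=> // i _; apply: ms.
Qed.

Section Covers.
Variables (T : finType) (F : sgraph T).

Lemma cover_number_le (C : {set T}) : vertex_cover F C -> (cover_number F <= #|C|)%N.
Proof.
by move=> covC; have [h _] := leq_bigminn (vertex_cover F) (fun C => #|C|) #|T|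
  (cover_number F); have [_] := h (leqnn _); apply.
Qed.

(** The bound [m < #|T|] excludes the default value of the minimum, so that the minimum comes from
    an actual cover. *)
Lemma cover_number_ltP m : (m < #|T|)%N -> (cover_number F <= m)%N ->
  exists2 C, vertex_cover F C & (#|C| <= m)%N.
Proof.
move=> mT cm.
have [/existsP[C /andP[covC Cm]]|] := boolP [exists C, vertex_cover F C && (#|C| <= m)%N].
  by exists C.
rewrite negb_exists => /forallP h.
have [_ h'] := leq_bigminn (vertex_cover F) (fun C => #|C|) #|T| m.+1.
suff: (m < cover_number F)%N by rewrite ltnNge cm.
by apply: h'; split=> // C covC; have := h C; rewrite covC /= -ltnNge.
Qed.

Lemma min_degree_inP (A : {set T}) m : (m <= #|T|)%N ->
  (m <= min_degree_in F A)%N <-> {in A, forall x, m <= degree F x}%N.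
Proof.
move=> mT; have [h1 h2] := leq_bigminn (mem A) (degree F) #|T| m.
split=> [/h1[_ h] x xA|h]; first exact: h.
by apply: h2.
Qed.

End Covers.

(** * Bipartite trees *)

Section BipartiteTree.
Variables (T : finType) (F : sgraph T) (A B : {set T}).
Hypotheses (treeF : is_tree F) (AB : partite_sets F A B).

Lemma partiteC : partite_sets F B A.
Proof. by have [h1 h2 h3 h4] := AB; split; rewrite // 1?setUC 1?disjoint_sym. Qed.

Lemma inAB t : (t \in B) = (t \notin A).
Proof.
have [h1 h2 _ _] := AB; have : t \in A :|: B by rewrite h1 inE.
rewrite inE; have [tA _|//] := boolP (t \in A).
by rewrite (disjointFr h2).
Qed.

Lemma adjAB u v : adj F u v -> (v \in A) = (u \in B).
Proof.
have [_ _ iA iB] := AB => uv; rewrite inAB.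
have [uA|uA] := boolP (u \in A).
  by apply: contraTF uv => vA; apply: iA.
apply: contraTT uv => vA; apply: iB; by rewrite inAB.
Qed.

Lemma adjBA u v : adj F u v -> (v \in B) = (u \in A).
Proof. by move=> uv; rewrite adj_sym in uv; rewrite (adjAB uv). Qed.

Lemma partite_cover : vertex_cover F A.
Proof.
apply/forallP => x; apply/forallP => y; apply/implyP => /adjAB->.
by rewrite inAB orbN.
Qed.

Lemma card_partite : (#|A| + #|B| = #|T|)%N.
Proof.
have [h1 h2 _ _] := AB.
by rewrite -cardsT -h1 cardsU (disjoint_setI0 h2) cards0 subn0.
Qed.

Lemma degree_gt0 x : (1 < #|T|)%N -> exists y, adj F x y.
Proof.
move=> T_gt1; have /card_gt1P[y [z [_ _ yz]]] : (1 < #|[set: T]|)%N by rewrite cardsT.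
have [v0 xv0] : exists v0, x != v0.
  by have [xy|] := eqVneq x y; [exists z; rewrite xy|exists y].
have [par [r [h _]]] := tree_parent treeF v0.
by exists (par x); have [] := h x xv0.
Qed.

(** Since [A] is a partite set, the sum counts each edge once. Every edge joins a vertex other than
    the root to its parent, so there are at most [#|T| - 1] edges. *)
Lemma sum_degree_le : (\sum_(a in A) degree F a < #|T|)%N.
Proof.
have [T_gt0 _] := treeF; have /card_gt0P[v0 _] := T_gt0.
have [par [r [_ h]]] := tree_parent treeF v0.
have degE a : a \in A -> degree F a = (\sum_(b in B) adj F a b)%N.
  move=> aA; rewrite /degree -sum1dep_card big_mkcond [RHS]big_mkcond /=.
  apply: eq_bigr => b _; case: ifPn => [ab|ab]; last by case: ifP.
  by rewrite (adjBA ab) aA.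
rewrite (eq_bigr _ degE).
have le_ab : (\sum_(a in A) \sum_(b in B) adj F a b <=
   \sum_(a in A) \sum_(b in B) (((a != v0) && (par a == b)) +
       ((b != v0) && (par b == a))))%N.
  apply: leq_sum => a _; apply: leq_sum => b _.
  by case: (boolP (adj F a b)) => // /h [[-> ->]|[-> ->]]; rewrite eqxx ?addn1.
apply: leq_ltn_trans le_ab _.
under eq_bigr do rewrite big_split /=.
rewrite big_split /= [X in (_ + X)%N]exchange_big /=.
have bnd (X Y : {set T}) : (\sum_(a in X) \sum_(b in Y) ((a != v0) && (par a == b))
     <= \sum_(a in X) (a != v0))%N.
  apply: leq_sum => a _; case: (a != v0); last by rewrite big1.
  apply: leq_trans (_ : (\sum_(b | b == par a) 1 <= _)%N); last by rewrite sum1_card card1.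
  rewrite big_mkcond [X in (_ <= X)%N]big_mkcond /=; apply: leq_sum => b _.
  by rewrite eq_sym; case: (b \in Y); case: eqP.
apply: leq_ltn_trans (leq_add (bnd A B) (bnd B A)) _.
have [h1 h2 _ _] := AB.
rewrite -bigU //= (eq_bigl xpredT); last by move=> i; rewrite !inE inAB orbN.
have -> : (\sum_(i : T) (i != v0) = #|[set~ v0]|)%N.
  rewrite -sum1_card [RHS]big_mkcond /=; apply: eq_bigr => i _.
  by rewrite !inE; case: eqP.
by rewrite cardsC1 prednK.
Qed.

(** Otherwise the degrees in [A] would sum to at least [2 #|A|], more than the number of edges. *)
Lemma partite_leaf : (#|T| <= #|A|.*2)%N -> exists2 x, x \in A & (degree F x <= 1)%N.
Proof.
move=> TA; have [/existsP[x /andP[xA dx]]|] :=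
  boolP [exists x, (x \in A) && (degree F x <= 1)%N]; first by exists x.
rewrite negb_exists => /forallP h; have := sum_degree_le.
suff: (\sum_(a in A) 2 <= \sum_(a in A) degree F a)%N by rewrite sum_nat_const; lia.
by apply: leq_sum => a aA; have := h a; rewrite aA /= -ltnNge.
Qed.

Lemma partite_degree2 : (#|T| <= #|A|.*2.+1)%N ->
  {in A, forall a, 2 <= degree F a}%N -> {in A, forall a, degree F a = 2}%N.
Proof.
move=> TA h a aA; apply/eqP; rewrite eqn_leq h // andbT.
have := sum_degree_le; rewrite (bigD1 a) //=.
have : (\sum_(i in A | i != a) 2 <= \sum_(i in A | i != a) degree F i)%N.
  by apply: leq_sum => i /andP[iA _]; apply: h.
rewrite sum_nat_const.
have -> : #|[pred i in A | i != a]| = #|A|.-1.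
  rewrite (cardsD1 a A) aA /=; apply: eq_card => i; by rewrite !inE andbC.
have : (0 < #|A|)%N by apply/card_gt0P; exists a.
move: TA; move: (\sum_(i in A | i != a) _)%N (degree F a) #|A| #|T|; clear; lia.
Qed.

Lemma leaf_neighbor x y z : (degree F x <= 1)%N -> adj F x y -> adj F x z -> y = z.
Proof. by move=> /card_le1_eqP h xy xz; apply: h; rewrite inE. Qed.

Section Subdivision.
Hypothesis deg2 : {in A, forall a, degree F a = 2}.

(** With the root in [B], no vertex of [A] is the root, so the two neighbors of [a] are its parent
    and a single child [c a]. *)
Lemma subdivision_structure v0 : v0 \in B ->
  exists (par c : T -> T) (r : T -> nat),
  [/\ forall v, v != v0 -> adj F v (par v) /\ (r (par v) < r v)%N,
      forall u v, adj F u v -> u != v0 /\ par u = v \/ v != v0 /\ par v = u,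
      forall a, a \in A -> [/\ c a \in B, c a != v0, par (c a) = a &
        (r a < r (c a))%N] &
      forall a b, a \in A -> adj F a b -> b = par a \/ b = c a].
Proof.
move=> v0B; have [par [r [h1 h2]]] := tree_parent treeF v0.
have av0 a : a \in A -> a != v0.
  by apply: contraTneq => ->; rewrite -inAB.
pose c a := odflt a [pick b | adj F a b && (b != par a)].
have cP a : a \in A -> adj F a (c a) /\ (c a != par a).
  move=> aA; rewrite /c; case: pickP => [b /andP[]//|no].
  have : (#|[set y | adj F a y]| <= #|[set par a]|)%N.
    apply: subset_leq_card; apply/subsetP => b; rewrite !inE => ab.
    by have := no b; rewrite ab /=; case: eqP.
  by rewrite cards1 -[#|_|]/(degree F a) deg2.
exists par, c, r; split => // [a aA|a b aA ab].
  have [ac cpar] := cP a aA.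
  have [[_ e]|[cv0 e]] := h2 _ _ ac; first by rewrite e eqxx in cpar.
  rewrite (adjBA ac) aA; split => //.
  by have [_] := h1 _ cv0; rewrite e.
have [ac cpar] := cP a aA; have [apar _] := h1 a (av0 a aA).
have [->|bp] := eqVneq b (par a); first by left.
have [->|bc] := eqVneq b (c a); first by right.
have : (#|b |: [set c a; par a]| <= #|[set y | adj F a y]|)%N.
  apply: subset_leq_card; apply/subsetP => y; rewrite !inE.
  by case/or3P=> /eqP->.
by rewrite -[X in (_ <= X)%N]/(degree F a) deg2 // cardsU1 !inE negb_or bc bp /= cards2 cpar.
Qed.

(* Each vertex of [A] is matched with its child, so that [v] is left over. *)
Lemma subdivision_cover v (C : {set T}) : v \in B -> v \in C ->
  vertex_cover F C -> (#|A| < #|C|)%N.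
Proof.
move=> vB vC covC; have [par [c [r [h1 h2 h3 h4]]]] := subdivision_structure vB.
pose f a := if a \in C then a else c a.
have fC : f @: A \subset C :\ v.
  apply/subsetP => _ /imsetP[a aA ->]; have [cB cv pc rc] := h3 a aA.
  rewrite /f !inE; have [aC|aC] := boolP (a \in C).
    rewrite aC andbT; apply: contraTneq aA => ->; by rewrite -inAB.
  rewrite cv /=; have [ac _] := h1 _ cv; rewrite pc in ac.
  have /forallP/(_ (c a))/forallP/(_ a)/implyP/(_ ac) := covC.
  by rewrite (negPf aC) orbF.
have injf : {in A &, injective f}.
  move=> a a' aA a'A; rewrite /f.
  have [cB _ pc _] := h3 a aA; have [c'B _ pc' _] := h3 a' a'A.
  case: ifPn => _; case: ifPn => _ //.
  - by move=> e; rewrite -e inAB aA in c'B.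
  - by move=> e; rewrite e inAB a'A in cB.
  - by move=> e; rewrite -pc e.
have := subset_leq_card fC; rewrite card_in_imset // => h.
by rewrite (cardsD1 v C) vC.
Qed.

End Subdivision.
End BipartiteTree.

(** * Copies of a tree in a complete bipartite graph with a few extra edges *)

Section ForbiddenConfigurations.
Variables (T V : finType) (F : sgraph T) (G : sgraph V) (A B : {set T}).
Variables (L R : {set V}).
Hypotheses (treeF : is_tree F) (AB : partite_sets F A B).
Hypotheses (LR : [disjoint L & R]) (adjLR : {in L & R, forall u v, adj G u v}).
Hypothesis (TR : (#|T|.*2 <= #|R|)%N).

Lemma bipartite_copy : (#|A| <= #|L|)%N -> contains_copy F G.
Proof.
move=> AL; have [T_gt0 _] := treeF.
have /card_gt0P[v _] : (0 < #|R|)%N by lia.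
apply: (@embedding_lemma _ _ F G L R A set0 (fun=> v)) => //.
- by move=> s t sA tA st; have := adjAB AB st; rewrite tA (inAB AB) sA.
- by move=> s t; rewrite inE.
- by move=> s; rewrite inE.
- by move=> s t; rewrite inE.
- by move=> s t; rewrite inE.
- by move=> s t st; rewrite -!(inAB AB) (adjBA AB st) (inAB AB) => /negPf->.
Qed.

(** The leaf [x] and its neighbor are placed on [v] and [u], which saves one place in [L]. As [v] is
    any vertex outside [L], this excludes edges inside [R] as well as edges leaving [L] and [R]
    altogether. *)
Lemma leaf_copy x u v : x \in A -> (degree F x <= 1)%N -> (1 < #|T|)%N ->
  (#|A| <= #|L|.+1)%N -> u \in R -> v \notin L -> adj G u v -> contains_copy F G.
Proof.
move=> xA dx T_gt1 AL uR vL uv; have [b xb] := degree_gt0 treeF x T_gt1.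
have bB : b \in B by rewrite (adjBA AB xb).
have bA : b \notin A by rewrite -(inAB AB).
have bx : (b == x) = false by apply: contraNF bA => /eqP->.
have uL : u \notin L by rewrite (disjointFl LR).
apply: (@embedding_lemma _ _ F G L R (A :\ x) [set x; b]
          (fun t => if t == x then v else u)) => //.
- by rewrite (cardsD1 x) xA add1n ltnS in AL.
- move=> s t; rewrite !inE => /andP[_ sA] /andP[_ tA] st.
  by have := adjAB AB st; rewrite tA (inAB AB) sA.
- have nuv : u == v = false by rewrite (negPf (adj_neq uv)).
  move=> s t; rewrite !inE => /orP[] /eqP-> /orP[] /eqP->; rewrite ?eqxx ?bx //.
    by move/eqP; rewrite eq_sym nuv.
  by move/eqP; rewrite nuv.
- by move=> s _; case: ifP.
- move=> s t; rewrite !inE => /orP[] /eqP-> /andP[_ tA]; rewrite ?bx //.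
  by move=> st; have := adjAB AB st; rewrite tA (inAB AB) xA.
- move=> s t; rewrite !inE => /orP[] /eqP-> /orP[] /eqP->; rewrite ?eqxx ?bx ?adj_irr //.
  by rewrite [adj G v u]adj_sym.
- have h s t : adj F s t -> s \in A -> s \notin A :\ x -> s = x /\ t = b.
    move=> st sA; rewrite !inE sA andbT negbK => /eqP sx; split=> //.
    by apply: (leaf_neighbor dx) => //; rewrite -sx.
  move=> s t st sC tC; rewrite !inE; have [sA|sA] := boolP (s \in A).
    by have [-> ->] := h s t st sA sC; rewrite !eqxx orbT.
  have tA : t \in A by rewrite (adjAB AB st) (inAB AB).
  rewrite adj_sym in st.
  by have [-> ->] := h t s st tA tC; rewrite !eqxx orbT.
Qed.

(** As for a leaf, [x] is kept out of [L]; its two neighbors occupy [u1] and [u2]. *)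
Lemma path_copy x u1 u2 v : x \in A -> degree F x = 2 ->
  (#|A| <= #|L|.+1)%N -> u1 \in R -> u2 \in R -> u1 != u2 -> v \notin L ->
  adj G v u1 -> adj G v u2 -> contains_copy F G.
Proof.
move=> xA dx AL u1R u2R u12 vL vu1 vu2.
have /eqP/cards2P[b1 [b2 [b12 NE]]] := dx.
have xb1 : adj F x b1 by have := set21 b1 b2; rewrite -NE inE.
have xb2 : adj F x b2 by have := set22 b1 b2; rewrite -NE inE.
have bA1 : b1 \notin A by rewrite -(inAB AB) (adjBA AB xb1).
have bA2 : b2 \notin A by rewrite -(inAB AB) (adjBA AB xb2).
have bx1 : (b1 == x) = false by apply: contraNF bA1 => /eqP->.
have bx2 : (b2 == x) = false by apply: contraNF bA2 => /eqP->.
have vn1 := adj_neq vu1; have vn2 := adj_neq vu2.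
have b21 : (b2 == b1) = false by rewrite eq_sym (negPf b12).
have noBB s t : s \notin A -> t \notin A -> adj F s t = false.
  by move=> sA tA; apply/negP => st; have := adjAB AB st; rewrite (inAB AB) sA (negPf tA).
apply: (@embedding_lemma _ _ F G L R (A :\ x) (x |: [set b1; b2])
          (fun t => if t == x then v else if t == b1 then u1 else u2)) => //.
- by rewrite (cardsD1 x) xA add1n ltnS in AL.
- move=> s t; rewrite !inE => /andP[_ sA] /andP[_ tA] st.
  by have := adjAB AB st; rewrite tA (inAB AB) sA.
- move=> s t; rewrite !inE => /or3P[] /eqP-> /or3P[] /eqP->;
    rewrite ?eqxx ?bx1 ?bx2 ?b21 // => /eqP; rewrite 1?eq_sym //;
    rewrite ?(negPf vn1) ?(negPf vn2) ?(negPf u12) //;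
    by rewrite eq_sym ?(negPf vn1) ?(negPf vn2) ?(negPf u12).
- move=> s _; case: ifP => // _; case: ifP => _; by rewrite (disjointFl LR).
- move=> s t; rewrite !inE => /or3P[] /eqP-> /andP[_ tA];
    rewrite ?eqxx ?bx1 ?bx2 ?b21 //.
  by move=> st; have := adjAB AB st; rewrite tA (inAB AB) xA.
- move=> s t; rewrite !inE => /or3P[] /eqP-> /or3P[] /eqP->;
    rewrite ?eqxx ?bx1 ?bx2 ?b21 ?adj_irr // ?(noBB b1 b2) ?(noBB b2 b1) //;
    by rewrite [adj G _ v]adj_sym.
- have h s t : adj F s t -> s \in A -> s \notin A :\ x -> s = x /\ t \in [set b1; b2].
    move=> st sA; rewrite !inE sA andbT negbK => /eqP sx; split=> //.
    by have : t \in [set y | adj F x y] by [rewrite inE -sx]; rewrite NE !inE.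
  move=> s t st sC tC; rewrite !inE; have [sA|sA] := boolP (s \in A).
    by have [-> ] := h s t st sA sC; rewrite !inE eqxx => ->; rewrite orbT.
  have tA : t \in A by rewrite (adjAB AB st) (inAB AB).
  rewrite adj_sym in st.
  by have [-> ] := h t s st tA tC; rewrite !inE eqxx => ->; rewrite orbT.
Qed.

(* Rooting the tree at a leaf of [B], let [b] be the last vertex of [B] below
   the root with a child, [x] a child and [y] the parent of [b].  Since [b]'s
   grandchildren are leaves, moving [b] and the other grandchildren into the
   part mapped to [L], in exchange for [b]'s neighbors, leaves uncovered only
   the edge below [x] and the edge above [y]. *)
Lemma two_edges_copy u v u' v' :
  {in A, forall a, degree F a = 2} -> #|B| = #|A|.+1 -> (1 < #|A|)%N ->
  (#|A| <= #|L|.+1)%N ->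
  {subset [:: u; v; u'; v'] <= R} -> uniq [:: u; v; u'; v'] ->
  adj G u v -> adj G u' v' -> contains_copy F G.
Proof.
move=> deg2 BA A_gt1 AL subR; rewrite /= !inE !negb_or !andbT.
move=> /and3P[/and3P[uv uu' uv'] /andP[vu' vv'] u'v'] adjuv adjuv'.
have [v0 v0B dv0] : exists2 v0, v0 \in B & (degree F v0 <= 1)%N.
  apply: (partite_leaf treeF (partiteC AB)).
  by rewrite -(card_partite AB) BA -addnn leq_add2r.
have [par [c [r [h1 h2 h3 h4]]]] := subdivision_structure treeF AB deg2 v0B.
have av0 a : a \in A -> a != v0.
  by apply: contraTneq => ->; rewrite -(inAB AB).
have apar a : a \in A -> adj F a (par a) by move=> aA; have [] := h1 a (av0 a aA).
have rpar a : a \in A -> (r (par a) < r a)%N by move=> aA; have [] := h1 a (av0 a aA).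
have parB a : a \in A -> par a \in B by move=> aA; rewrite (adjBA AB (apar a aA)).
have nAB a b : a \in A -> b \in B -> a != b.
  by move=> aA bB; apply: contraTneq aA => ->; rewrite -(inAB AB).
(* This is why the root is a leaf: it has at most one child, so one of the vertices of [A] hangs
   below another vertex of [B], and that vertex has a parent. *)
have [x0 /andP[x0A x0v0]] : exists x, (x \in A) && (par x != v0).
  apply/existsP; rewrite -[X in is_true X]negbK negb_exists; apply/negP => /forallP h.
  have /card_gt1P[a [a' [aA a'A /eqP]]] := A_gt1; apply.
  have := h a; have := h a'; rewrite aA a'A /= !negbK => /eqP p' /eqP p.
  apply: (leaf_neighbor dv0); rewrite adj_sym.
    by rewrite -p apar.
  by rewrite -p' apar.
case: (@arg_maxnP _ x0 (fun x => (x \in A) && (par x != v0)) (fun x => r (par x))).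
  by rewrite x0A.
move=> x /andP[xA bv0] xmax; pose b := par x; pose y := par b.
rewrite -/b in bv0 xmax.
have bB : b \in B := parB x xA.
have [by_ ryb] := h1 b bv0; rewrite -/y in by_ ryb.
have yA : y \in A by rewrite (adjAB AB by_).
have rbx := rpar x xA; rewrite -/b in rbx.
have yx : y != x by apply: contraTneq ryb => ->; rewrite -leqNgt ltnW.
have cyb : c y = b.
  have [] := h4 y b yA; rewrite 1?adj_sym // => bE.
  by have := rpar y yA; rewrite -bE ltnNge (ltnW ryb).
have adjb a : a \in A -> adj F a b -> a != y -> par a = b.
  move=> aA ab ay; have [[_ ]//|[_ e]] := h2 a b ab.
  by rewrite -e eqxx in ay.
pose h a := if ~~ adj F a b then a else if a == y then b else c a.
pose C := h @: (A :\ x).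
have bC : b \in C.
  apply/imsetP; exists y; first by rewrite !inE yx yA.
  by rewrite /h adj_sym by_ /= eqxx.
have CP t : t \in C -> [\/ (t \in A) && ~~ adj F t b, t = b |
    exists a, [/\ a \in A, a != x, adj F a b, par a = b & t = c a]].
  case/imsetP=> a /setD1P[ax aA] ->; rewrite /h.
  case: ifPn => [ab|]; first by apply: Or31; rewrite aA.
  rewrite negbK => ab; case: ifPn => ay; first by apply: Or32.
  by apply: Or33; exists a; split=> //; apply: adjb.
(* Inside [C] no edge survives: a child [s] of [c a] would have a parent of rank larger than that of
   [b], against the choice of [x], and the parent [a] of [c a] is adjacent to [b], hence not in
   [C]. *)
have CAB s t : s \in A -> t \in B -> s \in C -> t \in C -> adj F s t = false.
  move=> sA tB sC tC.
  have sb : ~~ adj F s b.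
    case: (CP s sC) => [/andP[]//|sb|[a [aA _ _ _ sc]]].
      by have := nAB s b sA bB; rewrite sb eqxx.
    have [cB _ _ _] := h3 a aA; by have := nAB s _ sA cB; rewrite sc eqxx.
  case: (CP t tC) => [/andP[tA]|->|[a [aA _ ab pa ->]]].
  - by have := nAB t t tA tB; rewrite eqxx.
  - exact: negPf.
  - have [cB cv0 pc rc] := h3 a aA; apply/negP => sc.
    have [[_ ps]|[_]] := h2 _ _ sc.
      have := xmax s; rewrite sA ps cv0 => /(_ isT); rewrite /= leqNgt.
      by rewrite (ltn_trans _ rc) // -pa rpar.
    by rewrite pc => as_; rewrite -as_ ab in sb.
have [cxB cxv0 pcx rcx] := h3 x xA.
have pyB := parB y yA; have rpy := rpar y yA.
have pycx : par y != c x by apply: contraTneq rpy => ->;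
  rewrite -leqNgt ltnW // (ltn_trans ryb) // (ltn_trans rbx).
pose g t := if t == x then u else if t == c x then v else if t == y then u' else v'.
have gx : g x = u by rewrite /g eqxx.
have gcx : g (c x) = v.
  by rewrite /g eq_sym (negPf (nAB _ _ xA cxB)) eqxx.
have gy : g y = u'.
  by rewrite /g (negPf yx) (negPf (nAB _ _ yA cxB)) eqxx.
have gpy : g (par y) = v'.
  rewrite /g eq_sym (negPf (nAB _ _ xA pyB)) (negPf pycx).
  by rewrite eq_sym (negPf (nAB _ _ yA pyB)).
pose D := [set x; c x; y; par y].
have DP t : t \in D -> [\/ t = x, t = c x, t = y | t = par y].
  rewrite !inE -!orbA => /or4P[] /eqP->.
  - exact: Or41.
  - exact: Or42.
  - exact: Or43.
  - exact: Or44.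
have gR t : g t \in R.
  rewrite /g; case: ifP => _; first by apply: subR; rewrite !inE eqxx.
  case: ifP => _; first by apply: subR; rewrite !inE eqxx ?orbT.
  by case: ifP => _; apply: subR; rewrite !inE eqxx ?orbT.
apply: (@embedding_lemma _ _ F G L R C D g) => //.
- apply: leq_trans (leq_imset_card _ _) _.
  by rewrite (cardsD1 x) xA add1n ltnS in AL.
- move=> s t sC tC st; have [sA|sA] := boolP (s \in A).
    have tB : t \in B by rewrite (adjBA AB st).
    by rewrite CAB in st.
  have tA : t \in A by rewrite (adjAB AB st) (inAB AB).
  by move: st; rewrite adj_sym CAB // (inAB AB).
- move=> s t /DP[] -> /DP[] ->; rewrite ?gx ?gcx ?gy ?gpy // => /eqP e; exfalso;
    by move: e uv uu' uv' vu' vv' u'v'; rewrite 1?eq_sym => ->.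
- by move=> s _; rewrite (disjointFl LR).
- have nxpy : adj F x (par y) = false.
    apply/negP => /(h4 _ _ xA)[e|e]; last by rewrite e eqxx in pycx.
    by move: rpy; rewrite e -/b ltnNge (ltnW ryb).
  have nycx : adj F y (c x) = false.
    apply/negP => /(h4 _ _ yA)[e|]; first by rewrite e eqxx in pycx.
    by rewrite cyb => e; move: rcx; rewrite e ltnNge (ltnW rbx).
  have noAA s t : s \in A -> t \in A -> adj F s t = false.
    by move=> sA tA; apply/negP => st; have := adjAB AB st; rewrite (inAB AB) sA tA.
  have noBB s t : s \in B -> t \in B -> adj F s t = false.
    by move=> sB tB; apply/negP => st; have := adjBA AB st; rewrite tB -[LHS]sB (inAB AB); case: (s \in A).
  move=> s t /DP[] -> /DP[] ->; rewrite ?gx ?gcx ?gy ?gpy //;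
    rewrite ?adj_irr // ?(noAA x y) ?(noAA y x) ?(noBB (c x) (par y)) ?(noBB (par y) (c x)) ?nxpy ?nycx //;
    by rewrite adj_sym ?nxpy ?nycx // => _; rewrite adj_sym.
- have H s t : s \in A -> adj F s t -> s \notin C -> t \notin C -> s \in D /\ t \in D.
    move=> sA st sC tC.
    have tb : t != b by apply: contraNneq tC => ->.
    have [sx|sx] := eqVneq s x.
      have := h4 _ _ sA st; rewrite sx -/b => -[e|->]; first by rewrite e eqxx in tb.
      by rewrite !inE !eqxx !orbT.
    have [sy|sy] := eqVneq s y.
      have := h4 _ _ sA st; rewrite sy cyb => -[->|e]; last by rewrite e eqxx in tb.
      by rewrite !inE !eqxx !orbT.
    have hsC : h s \in C by apply: imset_f; rewrite !inE sx.
    move: hsC; rewrite /h; case: ifPn => [_|]; first by rewrite (negPf sC).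
    rewrite negbK (negPf sy) => sb csC.
    have [e|e] := h4 _ _ sA st; last by rewrite e csC in tC.
    by rewrite e (adjb s) ?eqxx in tb.
  move=> s t st sC tC; have [sA|sA] := boolP (s \in A); first exact: H.
  have tA : t \in A by rewrite (adjAB AB st) (inAB AB).
  by have [] := H t s tA _ tC sC; rewrite 1?adj_sym.
Qed.

End ForbiddenConfigurations.

(** * The graphs [S_{n,k}^p] *)

Lemma adj_S n k p (i j : 'I_n) : adj (S_graph n k p) i j = S_rel k p i j.
Proof. by rewrite /adj /= inE. Qed.

Lemma card_ord_lt n k : (k <= n)%N -> #|[set i : 'I_n | (i < k)%N]| = k.
Proof.
move=> kn; have -> : [set i : 'I_n | (i < k)%N] = [set widen_ord kn j | j : 'I_k].
  apply/setP => i; rewrite !inE; apply/idP/imsetP => [ik|[j _ ->]]; last exact: (ltn_ord j).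
  by exists (Ordinal ik) => //; apply: val_inj.
by rewrite card_imset ?card_ord // => i j /(congr1 val) /= /val_inj.
Qed.

Lemma card_ord_ge n k : (k <= n)%N -> #|[set i : 'I_n | (k <= i)%N]| = (n - k)%N.
Proof.
move=> kn; have -> : [set i : 'I_n | (k <= i)%N] = ~: [set i : 'I_n | (i < k)%N].
  by apply/setP => i; rewrite !inE -leqNgt.
by rewrite cardsCs setCK card_ord_lt ?card_ord.
Qed.

Section ExtremalGraph.
Variables (n k : nat).
Hypothesis kn : (k <= n)%N.

(** The cover goes into the clique, where the edges inside the cover find room, and the remaining
    independent vertices go anywhere else. Hence freeness of [S_graph n k p] forces the cover number
    above [k]. *)
Lemma S_cover_copy (T : finType) (F : sgraph T) p (C : {set T}) : vertex_cover F C ->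
  (#|C| <= k)%N -> (k + #|T|.*2 < n)%N -> contains_copy F (S_graph n k p).
Proof.
move=> covC Ck Tn; have n_gt0 : (0 < n)%N by lia.
apply: (@embedding_lemma _ _ F _ [set i : 'I_n | (i < k)%N] [set i : 'I_n | (k <= i)%N]
  C set0 (fun=> Ordinal n_gt0)).
- by rewrite disjoints_subset; apply/subsetP => i; rewrite !inE -ltnNge.
- move=> u v; rewrite !inE => uk vk; rewrite adj_S /S_rel uk andbT.
  by rewrite neq_ltn (leq_trans uk).
- by rewrite card_ord_lt.
- by rewrite card_ord_ge //; lia.
- by move=> s t _ _ _ u v; rewrite !inE => uk vk uv; rewrite adj_S /S_rel uv uk.
- by move=> s t; rewrite inE.
- by move=> s; rewrite in_set0.
- by move=> s t; rewrite in_set0.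
- by move=> s t; rewrite in_set0.
- move=> s t st; have /forallP/(_ s)/forallP/(_ t)/implyP/(_ st) := covC.
  by case: (s \in C) => //= ->.
Qed.

(** The vertices that a copy sends into the clique cover all edges of [F]. *)
Lemma S0_free (T : finType) (F : sgraph T) : (k < cover_number F)%N ->
  is_free F (S_graph n k 0).
Proof.
move=> kF; apply/negP => /existsP[f /andP[/injectiveP injf /forallP homf]].
have : vertex_cover F [set t | (f t < k)%N].
  apply/forallP => s; apply/forallP => t; apply/implyP => st; rewrite !inE.
  have /forallP/(_ t)/implyP/(_ st) := homf s; rewrite adj_S /S_rel => /andP[_].
  by rewrite ltn0 andbF orbF.
move/cover_number_le; rewrite leqNgt => /negP; apply.
apply: leq_ltn_trans kF; rewrite -(card_imset _ injf) -[X in (_ <= X)%N](card_ord_lt kn).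
by apply: subset_leq_card; apply/subsetP => _ /imsetP[t + ->]; rewrite !inE.
Qed.

Lemma S1_leaf_copy (T : finType) (F : sgraph T) (A B : {set T}) x : is_tree F ->
  partite_sets F A B -> x \in A -> (degree F x <= 1)%N -> (1 < #|T|)%N ->
  (#|A| <= k.+1)%N -> (k + #|T|.*2 < n)%N -> contains_copy F (S_graph n k 1).
Proof.
move=> treeF AB xA dx T1 Ak Tn.
have k_lt : (k < n)%N by lia.
have k1_lt : (k.+1 < n)%N by lia.
apply: (@leaf_copy _ _ F _ A B [set i : 'I_n | (i < k)%N] [set i : 'I_n | (k <= i)%N]
  treeF AB _ _ _ x (Ordinal k_lt) (Ordinal k1_lt)) => //.
- by rewrite disjoints_subset; apply/subsetP => i; rewrite !inE -ltnNge.
- move=> u v; rewrite !inE => uk vk; rewrite adj_S /S_rel uk andbT.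
  by rewrite neq_ltn (leq_trans uk).
- by rewrite card_ord_ge //; lia.
- by rewrite card_ord_lt.
- by rewrite inE /=.
- by rewrite inE /= -leqNgt.
- by rewrite adj_S /S_rel -val_eqE /= subnn subSnn; lia.
Qed.

(** In a copy, the vertices sent into the clique miss only an edge sent onto [{k, k+1}]. Adding the
    end of that edge in [B] gives a cover with at most [k + 1] vertices that meets [B], which
    [subdivision_cover] excludes. *)
Lemma S1_free (T : finType) (F : sgraph T) (A B : {set T}) : is_tree F ->
  partite_sets F A B -> {in A, forall a, degree F a = 2} -> #|A| = k.+1 ->
  (k < cover_number F)%N -> is_free F (S_graph n k 1).
Proof.
move=> treeF AB deg2 Ak kF; apply/negP => /existsP[f /andP[/injectiveP injf /forallP homf]].
pose C := [set t | (f t < k)%N].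
have Ck : (#|C| <= k)%N.
  rewrite -(card_imset _ injf) -[X in (_ <= X)%N](card_ord_lt kn).
  by apply: subset_leq_card; apply/subsetP => _ /imsetP[t + ->]; rewrite !inE.
have edge s t : adj F s t -> s \notin C -> t \notin C ->
    [/\ (k <= f s <= k.+1)%N, (k <= f t <= k.+1)%N & f s != f t :> nat].
  move=> st; rewrite !inE -!leqNgt => sC tC.
  have /forallP/(_ t)/implyP/(_ st) := homf s; rewrite adj_S /S_rel -val_eqE /=.
  by move: (val (f s)) (val (f t)) sC tC => i j sC tC h; split; lia.
have [covC|] := boolP (vertex_cover F C).
  by have := cover_number_le covC; rewrite leqNgt (leq_ltn_trans Ck kF).
rewrite negb_forall => /existsP[s]; rewrite negb_forall => /existsP[t].
rewrite negb_imply negb_or => /and3P[st sC tC].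
have [v [vB vC [/andP[v1 v2]]]] : exists v, [/\ v \in B, v \notin C & (k <= f v <= k.+1)%N].
  have [h1 h2 _] := edge s t st sC tC.
  have [sA|sA] := boolP (s \in A); first by exists t; rewrite (adjBA AB st).
  by exists s; rewrite (inAB AB).
have covvC : vertex_cover F (v |: C).
  apply/forallP => p; apply/forallP => q; apply/implyP => pq; rewrite !in_setU1.
  have [pC|pC] := boolP (p \in C); first by rewrite orbT.
  have [qC|qC] := boolP (q \in C); first by rewrite !orbT.
  have [/andP[p1 p2] /andP[q1 q2] pq'] := edge p q pq pC qC.
  rewrite !orbF -!(inj_eq injf) -!val_eqE /=.
  move: (val (f p)) (val (f q)) (val (f v)) p1 p2 q1 q2 v1 v2 pq' => i j m; lia.
have := subdivision_cover treeF AB deg2 vB (setU11 v C) covvC.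
by rewrite cardsU1 vC Ak add1n !ltnS leqNgt (leq_ltn_trans Ck).
Qed.

(** The vertices are renumbered by their position in a list: [L] first, then [e], then the rest. Two
    vertices in [e] thus receive the numbers [k] and [k + 1], the ends of the added edge. *)
Lemma S_bijection (L : {set 'I_n}) (e : seq 'I_n) (H : rel 'I_n) :
  #|L| = k -> uniq e -> {in e, forall v, v \notin L} -> (size e = 0 \/ size e = 2) ->
  (forall u v, u \notin L -> v \notin L -> H u v -> (u \in e) && (v \in e)) ->
  exists2 f : 'I_n -> 'I_n, bijective f & forall u v, u != v ->
    [|| u \in L, v \in L | H u v] -> adj (S_graph n k (size e)./2) (f u) (f v).
Proof.
move=> Lk ue eL se He.
pose s := enum L ++ e ++ [seq v <- enum (~: L) | v \notin e].
have us : uniq s.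
  rewrite !cat_uniq enum_uniq ue filter_uniq ?enum_uniq //= andbT; apply/andP; split.
    apply/hasPn => v; rewrite mem_cat mem_filter !mem_enum inE /=.
    by case/orP=> [/eL|/andP[_]].
  by apply/hasPn => v; rewrite mem_filter /= => /andP[].
have ms v : v \in s.
  rewrite !mem_cat mem_enum mem_filter mem_enum inE.
  by case: (v \in L) => //=; case: (v \in e).
have ss : size s = n.
  rewrite -(card_uniqP us) -[RHS]card_ord; apply: eq_card => v; by rewrite ms.
have lt v : (index v s < n)%N by rewrite -[X in (_ < X)%N]ss index_mem.
pose f v := Ordinal (lt v).
have idxL v : v \in L -> (index v s < k)%N.
  move=> vL; rewrite index_cat mem_enum vL -Lk cardE index_mem.
  by rewrite mem_enum.
have idxe v : v \in e -> index v s = (k + index v e)%N.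
  by move=> ve; rewrite index_cat mem_enum (negPf (eL v ve)) -cardE Lk index_cat ve.
have injf : injective f.
  move=> u v /(congr1 val) /= h.
  by rewrite -(nth_index u (ms u)) h nth_index.
exists f; first exact: injF_bij.
move=> u v uv; rewrite adj_S /S_rel (inj_eq injf) uv /=.
case/or3P=> [uL|vL|huv]; [by rewrite idxL|by rewrite (idxL v) // orbT|].
have [uL|uL] := boolP (u \in L); first by rewrite idxL.
have [vL|vL] := boolP (v \in L); first by rewrite (idxL v) // orbT.
have /andP[ue' ve'] := He u v uL vL huv.
rewrite !idxe // !addKn.
have : (index u e < size e)%N by rewrite index_mem.
have : (index v e < size e)%N by rewrite index_mem.
by case: se => -> //; case: (index u e) => [|[|?]]; case: (index v e) => [|[|?]] //;
  rewrite !orbT.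
Qed.

End ExtremalGraph.

(** * Spectral radius of a graph *)

Section GraphSpectrum.
Variable R : realType.
Local Open Scope ring_scope.
Implicit Types (n : nat).

Definition gform n (G : sgraph 'I_n) (x : 'I_n -> R) : R :=
  \sum_u \sum_v (adj G u v)%:R * x u * x v.

Lemma gformE n (G : sgraph 'I_n) x : gform G x = qform (adjmx R G) x.
Proof. by apply: eq_bigr => u _; apply: eq_bigr => v _; rewrite mxE. Qed.

Lemma adjmx_sym n (G : sgraph 'I_n) i j : adjmx R G i j = adjmx R G j i.
Proof. by rewrite !mxE adj_sym. Qed.

Lemma gform_le n (G : sgraph 'I_n) x : gform G x <= rho R G * \sum_i x i ^+ 2.
Proof. by rewrite gformE; apply: Rayleigh_le; apply: adjmx_sym. Qed.

Lemma gform_eq n (G : sgraph 'I_n) x : rho R G * (\sum_i x i ^+ 2) <= gform G x ->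
  forall u, \sum_v (adj G u v)%:R * x v = rho R G * x u.
Proof.
rewrite gformE => h u; rewrite -(Rayleigh_eq (@adjmx_sym n G) h).
by apply: eq_bigr => v _; rewrite mxE.
Qed.

Lemma graph_Perron n (G : sgraph 'I_n) : (0 < n)%N ->
  exists x : 'I_n -> R, [/\ forall u, 0 <= x u, exists u, 0 < x u &
    forall u, \sum_v (adj G u v)%:R * x v = rho R G * x u].
Proof.
move=> n_gt0; have [||x [x1 x2 x3]] := @Perron_vector R n (adjmx R G) n_gt0.
- exact: adjmx_sym.
- by move=> i j; rewrite mxE ler0n.
exists x; split=> // u; rewrite -[RHS]x3; apply: eq_bigr => v _; by rewrite mxE.
Qed.

Lemma eigen_gform n (G : sgraph 'I_n) x r :
  (forall u, \sum_v (adj G u v)%:R * x v = r * x u) ->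
  gform G x = r * \sum_u x u ^+ 2.
Proof.
move=> eig; rewrite /gform mulr_sumr; apply: eq_bigr => u _.
rewrite expr2 mulrA -eig mulr_suml; apply: eq_bigr => v _; ring.
Qed.

Lemma rho_ge0 n (G : sgraph 'I_n) : 0 <= rho R G.
Proof. exact: spectral_radius_ge0. Qed.

Lemma gform_hom_le n (G H : sgraph 'I_n) (f g : 'I_n -> 'I_n) (x : 'I_n -> R) :
  cancel f g -> cancel g f -> (forall u, 0 <= x u) ->
  (forall u v, adj G u v -> adj H (f u) (f v)) ->
  gform G x <= gform H (x \o g).
Proof.
move=> fK gK x_ge0 hom.
rewrite /gform [leRHS](reindex f) /=; last by exists g => u _; rewrite ?fK ?gK.
apply: ler_sum => u _.
rewrite [leRHS](reindex f) /=; last by exists g => v _; rewrite ?fK ?gK.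
apply: ler_sum => v _; rewrite !fK -!mulrA; apply: ler_wpM2r.
  by rewrite mulr_ge0.
by rewrite ler_nat; have := hom u v; case: (adj G u v) => // ->.
Qed.

Lemma sum_sqr_cancel n (f g : 'I_n -> 'I_n) (x : 'I_n -> R) :
  cancel f g -> cancel g f -> \sum_u (x \o g) u ^+ 2 = \sum_u x u ^+ 2.
Proof.
move=> fK gK; rewrite (reindex f) /=; last by exists g => u _; rewrite ?fK ?gK.
by apply: eq_bigr => u _; rewrite fK.
Qed.

Lemma sum_sqr_gt0 n (x : 'I_n -> R) : (exists u, 0 < x u) -> 0 < \sum_u x u ^+ 2.
Proof.
case=> u xu; rewrite (bigD1 u) //= ltr_pwDl ?exprn_gt0 //.
by apply: sumr_ge0 => v _; apply: sqr_ge0.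
Qed.

Lemma rho_hom_le n (G H : sgraph 'I_n) (f : 'I_n -> 'I_n) : (0 < n)%N ->
  bijective f -> (forall u v, adj G u v -> adj H (f u) (f v)) ->
  rho R G <= rho R H.
Proof.
move=> n_gt0 [g fK gK] hom; have [x [x1 x2 x3]] := graph_Perron G n_gt0.
have := gform_hom_le fK gK x1 hom; rewrite (eigen_gform x3) => h.
have := le_trans h (gform_le H _); rewrite (sum_sqr_cancel _ fK gK).
by rewrite ler_pM2r // sum_sqr_gt0.
Qed.

Lemma isomorphic_sym n (G H : sgraph 'I_n) : isomorphic G H -> isomorphic H G.
Proof.
case=> f [g fK gK] h; exists g; first by exists f.
by move=> x y; rewrite h !gK.
Qed.

Lemma rho_iso n (G H : sgraph 'I_n) : (0 < n)%N -> isomorphic G H ->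
  rho R G = rho R H.
Proof.
move=> n_gt0 GH; apply/le_anti/andP; split.
  by have [f bf h] := GH; apply: rho_hom_le bf _ => // u v; rewrite h.
by have [f bf h] := isomorphic_sym GH; apply: rho_hom_le bf _ => // u v; rewrite h.
Qed.

Lemma sum_bool_card (I : finType) (P : pred I) : \sum_i (P i)%:R = #|P|%:R :> R.
Proof.
rewrite -sum1_card natr_sum [RHS]big_mkcond /=; apply: eq_bigr => i _.
by rewrite -[in RHS]topredE /=; case: (P i).
Qed.

(** Rayleigh quotient of the vector equal to [t] on the clique and to 1 elsewhere, keeping only the
    edges between the two parts. *)
Lemma rho_S_ge n k p : (0 < k)%N -> (k < n)%N ->
  k%:R * (n - k)%:R <= rho R (S_graph n k p) ^+ 2.
Proof.
move=> k_gt0 kn; set r := rho R _.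
have key (t : R) : 0 <= t -> 2 * k%:R * (n - k)%:R * t <= r * (k%:R * t ^+ 2 + (n - k)%:R).
  move=> t_ge0; pose x (i : 'I_n) := if (i < k)%N then t else 1 : R.
  have := gform_le (S_graph n k p) x; rewrite -/r.
  have cs1 : \sum_(i < n) (i < k)%:R = k%:R :> R.
    by rewrite sum_bool_card -[in RHS](card_ord_lt (ltnW kn)) cardsE.
  have cs2 : \sum_(i < n) (k <= i)%:R = (n - k)%:R :> R.
    by rewrite sum_bool_card -[in RHS](card_ord_ge (ltnW kn)) cardsE.
  have -> : \sum_i x i ^+ 2 = k%:R * t ^+ 2 + (n - k)%:R.
    rewrite -cs1 -cs2 mulr_suml -big_split /=; apply: eq_bigr => i _.
    by rewrite /x; case: ltnP => _; rewrite ?mul1r ?mul0r ?addr0 ?add0r ?expr1n.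
  apply: le_trans.
  have -> : 2 * k%:R * (n - k)%:R * t =
      \sum_(u < n) \sum_(v < n) ((u < k)%:R * t * (k <= v)%:R + (k <= u)%:R * t * (v < k)%:R).
    under [RHS]eq_bigr do rewrite big_split /= -!mulr_sumr cs1 cs2.
    by rewrite big_split /= -!mulr_suml cs1 cs2; ring.
  apply: ler_sum => u _; apply: ler_sum => v _.
  rewrite adj_S /S_rel /x.
  have [->|uv] := eqVneq u v.
    by case: ltnP => _; rewrite /= ?(mul0r,mulr0,mul1r,addr0).
  by case: (ltnP u k) => _; case: (ltnP v k) => _ /=;
    rewrite ?(mul0r,mulr0,mul1r,mulr1,addr0,add0r) //; rewrite ?mulr_ge0 ?ler0n.
have k0 : 0 < k%:R :> R by rewrite ltr0n.
have nk0 : 0 < (n - k)%:R :> R by rewrite ltr0n subn_gt0.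
have r_ge0 : 0 <= r := rho_ge0 _.
have r_gt0 : 0 < r.
  rewrite lt_def r_ge0 andbT; apply/eqP => r0; have := key 1 ler01.
  rewrite r0 mul0r mulr1; have := mulr_gt0 k0 nk0; lra.
(* The best weight for the bipartite part is [sqrt (k (n - k)) / k]; putting [r] in place of the
   root avoids square roots. *)
have := key (r / k%:R) (divr_ge0 r_ge0 (ltW k0)).
have -> : 2 * k%:R * (n - k)%:R * (r / k%:R) = r * (2 * (n - k)%:R) by field; lra.
have -> : k%:R * (r / k%:R) ^+ 2 + (n - k)%:R = r ^+ 2 / k%:R + (n - k)%:R.
  by field; lra.
rewrite ler_pM2l // => h.
have : (n - k)%:R <= r ^+ 2 / k%:R by lra.
by rewrite ler_pdivlMr // mulrC.
Qed.

(** Positivity spreads along edges, and vertex 0 is adjacent to all others because [k > 0]. *)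
Lemma S_eigenvector_gt0 n k p (x : 'I_n -> R) : (0 < k)%N ->
  0 < rho R (S_graph n k p) ->
  (forall u, 0 <= x u) -> (exists u, 0 < x u) ->
  (forall u, \sum_v (adj (S_graph n k p) u v)%:R * x v = rho R (S_graph n k p) * x u) ->
  forall u, 0 < x u.
Proof.
move=> k_gt0 r_gt0 x_ge0 [u0 xu0] eig.
have n_gt0 : (0 < n)%N by case: (n) u0 {xu0 eig x_ge0} => [[]|].
pose o := Ordinal n_gt0.
have pos u v : adj (S_graph n k p) u v -> 0 < x v -> 0 < x u.
  move=> uv xv; rewrite -(pmulr_rgt0 _ r_gt0) -eig (bigD1 v) //= uv mul1r.
  by rewrite ltr_pwDl // sumr_ge0 // => w _; rewrite mulr_ge0 ?ler0n.
have oadj v : v != o -> adj (S_graph n k p) o v /\ adj (S_graph n k p) v o.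
  by move=> vo; rewrite !adj_S /S_rel /= k_gt0 vo eq_sym vo orbT.
have xo : 0 < x o.
  by have [<-//|u0o] := eqVneq u0 o; have [h _] := oadj u0 u0o; apply: pos h xu0.
move=> u; have [->//|uo] := eqVneq u o.
by have [_ h] := oadj u uo; apply: pos h xo.
Qed.

End GraphSpectrum.

(** * Comparison with the extremal graph *)

Lemma ler_sum_subset (R : numDomainType) (I : finType) (P Q : pred I) (f : I -> R) :
  (forall i, P i -> Q i) -> (forall i, Q i -> 0 <= f i)%R ->
  (\sum_(i | P i) f i <= \sum_(i | Q i) f i)%R.
Proof.
move=> PQ f_ge0; rewrite big_mkcond [leRHS]big_mkcond /=.
apply: ler_sum => i _; have := PQ i; have := f_ge0 i.
by case: (P i); case: (Q i) => // h1 h2; [have := h2 isT|apply: h1].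
Qed.

Section Orient.
Variables (R : realType) (V : finType) (G : sgraph V) (o : rel V) (l : nat).
Local Open Scope ring_scope.
Hypothesis oE : forall u v, (adj G u v = o u v + o v u :> nat)%N.
Hypothesis o_le : forall u, (#|[set v | o u v]| <= l)%N.

Lemma out_degree_le u (U : {set V}) : \sum_(v in U) (o u v)%:R <= l%:R :> R.
Proof.
apply: le_trans (_ : \sum_v (o u v)%:R <= _).
  by apply: ler_sum_subset => // v _; rewrite ler0n.
by rewrite sum_bool_card ler_nat; have := o_le u; rewrite cardsE.
Qed.

Lemma arcs_le (U : {set V}) :
  \sum_(u in U) \sum_(v in U) (adj G u v)%:R <= 2 * l%:R * #|U|%:R :> R.
Proof.
have -> : \sum_(u in U) \sum_(v in U) (adj G u v)%:R =
   \sum_(u in U) \sum_(v in U) (o u v)%:R + \sum_(u in U) \sum_(v in U) (o v u)%:R :> R.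
  rewrite -big_split /=; apply: eq_bigr => u _; rewrite -big_split /=.
  by apply: eq_bigr => v _; rewrite oE natrD.
rewrite [X in _ + X]exchange_big /=.
suff : \sum_(u in U) \sum_(v in U) (o u v)%:R <= l%:R * #|U|%:R :> R by lra.
apply: le_trans (_ : \sum_(u in U) l%:R <= _).
  by apply: ler_sum => u _; apply: out_degree_le.
by rewrite sumr_const -[leLHS]mulr_natr lexx.
Qed.

End Orient.

Section Comparison.
Variables (R : realType) (n k l : nat) (G : sgraph 'I_n) (L : {set 'I_n}).
Variables (o : rel 'I_n) (x : 'I_n -> R) (z : 'I_n) (r delta : R).
Local Open Scope ring_scope.

Let R0 := [set v | (v \notin L) && [forall u in L, adj G u v]].
Let E := [set v | (v \notin L) && (v \notin R0)].
Local Notation a u v := ((adj G u v)%:R : R).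

Hypothesis Lk : #|L| = k.
Hypothesis oE : forall u v, (adj G u v = o u v + o v u :> nat)%N.
Hypothesis o_le : forall u, (#|[set v | o u v]| <= l)%N.
Hypothesis x_ge0 : forall u, 0 <= x u.
Hypothesis x_le1 : forall u, x u <= 1.
Hypothesis xz : x z = 1.
Hypothesis r_ge0 : 0 <= r.
Hypothesis eig : forall u, \sum_v a u v * x v = r * x u.

Let a_ge0 u v : 0 <= a u v. Proof. exact: ler0n. Qed.
Let a_le1 u v : a u v <= 1. Proof. by case: (adj G u v). Qed.
Let a_sym u v : a u v = a v u. Proof. by rewrite adj_sym. Qed.
Let ax_le u v : a u v * x v <= a u v.
Proof. by rewrite ler_piMr. Qed.

Lemma walk2 u : r ^+ 2 * x u = \sum_w a u w * (r * x w).
Proof.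
rewrite expr2 -mulrA -eig mulr_sumr; apply: eq_bigr => w _; ring.
Qed.

(** Here [r^2 * x z] is a weighted count of the walks of length two from [z], bounded by the number
    of all arcs. *)
Lemma rho_sqr_le : r ^+ 2 <= 2 * l%:R * n%:R.
Proof.
have := walk2 z; rewrite xz mulr1 => ->.
apply: le_trans (_ : \sum_(w in [set: 'I_n]) \sum_(t in [set: 'I_n]) a w t <= _).
  rewrite [leRHS](eq_bigl xpredT) => [|w]; last by rewrite inE.
  apply: ler_sum => w _; apply: le_trans (_ : r * x w <= _).
    by rewrite ler_piMl // mulr_ge0.
  rewrite -eig [leRHS](eq_bigl xpredT) => [|t]; last by rewrite inE.
  by apply: ler_sum => t _.
by have := arcs_le R oE o_le [set: 'I_n]; rewrite cardsT card_ord.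
Qed.

Let sum3 (f : 'I_n -> R) :
  \sum_w f w = \sum_(w in L) f w + (\sum_(w in R0) f w + \sum_(w in E) f w).
Proof.
rewrite !(big_mkcond (fun i => i \in _)) -!big_split /=; apply: eq_bigr => w _.
have wR : w \in L -> (w \in R0) = false by rewrite inE => ->.
rewrite [w \in E]inE; case: (w \in L) wR => [->//|_]; first by rewrite !addr0.
by case: (w \in R0); rewrite ?addr0 ?add0r.
Qed.

Let sum2 (f : 'I_n -> R) :
  \sum_(w | w \notin L) f w = \sum_(w in R0) f w + \sum_(w in E) f w.
Proof.
rewrite !(big_mkcond (fun i => i \in _)) (big_mkcond (fun i => i \notin _)) -!big_split /=.
apply: eq_bigr => w _.
have wR : w \in L -> (w \in R0) = false by rewrite inE => ->.
rewrite [w \in E]inE; case: (w \in L) wR => [->//|_]; first by rewrite !addr0.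
by case: (w \in R0); rewrite ?addr0 ?add0r.
Qed.

Hypothesis R0_nbr : forall v u1 u2, v \notin L -> u1 \in R0 -> u2 \in R0 ->
  adj G v u1 -> adj G v u2 -> u1 = u2.

Lemma sum_R0_le1 v : v \notin L -> \sum_(w in R0) a v w <= 1.
Proof.
move=> vL.
have -> : \sum_(w in R0) a v w = \sum_w ((w \in R0) && adj G v w)%:R.
  by rewrite big_mkcond /=; apply: eq_bigr => w _; case: (w \in R0).
rewrite sum_bool_card -[leRHS]/(1%:R) ler_nat; apply/card_le1_eqP => u1 u2.
rewrite !unfold_in => /andP[h1 h2] /andP[h3 h4].
exact: (R0_nbr vL).
Qed.

(** Walks of length two from [v] are split by their steps. A first step into [L] contributes at most
    [r k]. Among the others, of which at most [#|E| + 1] begin, a second step into [L] gives the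
    factor [k], one into [R0] a factor 1, and one into [E] is counted from its end by [arcs_le]. *)
Lemma outer_le v : v \notin L ->
  r ^+ 2 * x v <= r * k%:R + (k%:R + 2 * l%:R + 2) * (#|E|%:R + 1).
Proof.
move=> vL; rewrite walk2 sum3 -sum2.
have sum_out u : u \notin L -> \sum_(w | w \notin L) a u w <= #|E|%:R + 1.
  move=> uL; rewrite sum2 addrC lerD ?sum_R0_le1 //.
  apply: le_trans (_ : \sum_(w in E) 1 <= _); last by rewrite sumr_const lexx.
  exact: ler_sum.
have h1 : \sum_(w in L) a v w * (r * x w) <= r * k%:R.
  apply: le_trans (_ : \sum_(w in L) r <= _); last by rewrite sumr_const Lk mulr_natr lexx.
  apply: ler_sum => w _; rewrite -[leRHS]mul1r ler_pM // ?mulr_ge0 //.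
  by rewrite ler_piMr.
have rx w : r * x w <= k%:R + \sum_(t | t \notin L) a w t.
  rewrite -eig sum3 -sum2 lerD //.
    apply: le_trans (_ : \sum_(w in L) 1 <= _); last by rewrite sumr_const Lk lexx.
    by apply: ler_sum => t _; apply: le_trans (ax_le _ _) _.
  by apply: ler_sum => t _.
have h2 : \sum_(w | w \notin L) a v w * (r * x w) <=
    k%:R * (#|E|%:R + 1) + \sum_(w | w \notin L) a v w * \sum_(t | t \notin L) a w t.
  apply: le_trans (_ : \sum_(w | w \notin L) a v w * (k%:R + \sum_(t | t \notin L) a w t) <= _).
    by apply: ler_sum => w _; rewrite ler_wpM2l.
  under eq_bigr do rewrite mulrDr; rewrite big_split /= lerD2r -mulr_suml mulrC.
  by rewrite ler_wpM2l ?sum_out.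
have h3 : \sum_(w | w \notin L) a v w * \sum_(t | t \notin L) a w t <=
    (#|E|%:R + 1) + \sum_(w | w \notin L) \sum_(t in E) a w t.
  apply: le_trans (_ : \sum_(w | w \notin L) (a v w + \sum_(t in E) a w t) <= _).
    apply: ler_sum => w wL; rewrite sum2 mulrDr lerD //.
      by rewrite ler_piMr // sum_R0_le1.
    by rewrite ler_piMl // sumr_ge0.
  by rewrite big_split /= lerD2r sum_out.
have h4 : \sum_(w | w \notin L) \sum_(t in E) a w t <= (1 + 2 * l%:R) * #|E|%:R.
  rewrite exchange_big /=.
  apply: le_trans (_ : \sum_(t in E) (1 + \sum_(w in E) a t w) <= _).
    apply: ler_sum => t; rewrite !inE => /andP[tL _].
    under eq_bigr do rewrite a_sym; by rewrite sum2 lerD2r sum_R0_le1.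
  rewrite big_split /= sumr_const mulrDl mul1r lerD2l; exact: arcs_le o_le _.
have l0 : 0 <= l%:R :> R by rewrite ler0n.
have e0 : 0 <= #|E|%:R :> R by rewrite ler0n.
lra.
Qed.

Hypothesis delta1 : delta < 1.
Hypothesis r_gt0 : 0 < r.
Hypothesis delta_le : r * k%:R + (k%:R + 2 * l%:R + 2) * (#|E|%:R + 1) <= delta * r ^+ 2.

Lemma outer_small v : v \notin L -> x v <= delta.
Proof.
move=> vL; have := le_trans (outer_le vL) delta_le.
by rewrite [delta * _]mulrC ler_pM2l // exprn_gt0.
Qed.

(** The maximal entry is at [z], which lies in [L] because outer entries are below 1. So each [w] in
    [R0], adjacent to [z], has [r * x w >= 1], and [u] sees all of [R0]. *)
Lemma inner_large u : u \in L -> #|R0|%:R / r ^+ 2 <= x u.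
Proof.
move=> uL; rewrite ler_pdivrMr ?exprn_gt0 // mulrC walk2.
have zL : z \in L.
  by apply: contraLR delta1 => /outer_small; rewrite xz -leNgt.
apply: le_trans (_ : \sum_(w in R0) 1 <= _); first by rewrite sumr_const lexx.
apply: le_trans (_ : \sum_(w in R0) a u w * (r * x w) <= _).
  apply: ler_sum => w; rewrite !inE => /andP[wL /forallP wR].
  rewrite (implyP (wR u) uL) mul1r -eig (bigD1 z) //= xz mulr1.
  rewrite adj_sym (implyP (wR z) zL) lerDl sumr_ge0 // => t _; exact: mulr_ge0.
by apply: ler_sum_subset => // w _; rewrite !mulr_ge0.
Qed.

Definition join_rel (u v : 'I_n) : bool := (u != v) &&
  [|| u \in L, v \in L | [&& u \in R0, v \in R0 & adj G u v]].

(* Trading the edges of [G] inside [E] and between [E] and [R0] for the missing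
   edges between [E] and [L] increases the quadratic form. *)
Lemma join_form_ge : 0 <= delta ->
  gform G x + 2 * (#|R0|%:R / r ^+ 2 - delta * (l%:R + 1)) * (\sum_(u in E) x u) <=
  \sum_u \sum_v (join_rel u v)%:R * x u * x v.
Proof.
move=> delta0; set c0 := _ / _.
(* [b1] marks the missing pairs between [E] and [L], [b2] the edges from [E] to [R0], and [b3] the
   arcs inside [E], oriented so that the bound on out-degrees applies. *)
pose b1 u v : R := ((u \in E) && (v \in L))%:R * (1 - a u v).
pose b2 u v : R := ((u \in E) && (v \in R0))%:R * a u v.
pose b3 u v : R := ((u \in E) && (v \in E))%:R * (o u v)%:R.
pose S (b : 'I_n -> 'I_n -> R) := \sum_u \sum_v b u v * x u * x v.
have symS b : \sum_u \sum_v b v u * x u * x v = S b.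
  rewrite /S exchange_big /=; apply: eq_bigr => u _; apply: eq_bigr => v _; ring.
have pt u v : a u v + b1 u v + b1 v u <= (join_rel u v)%:R + b2 u v + b2 v u + b3 u v + b3 v u.
  have oR : a u v = (o u v)%:R + (o v u)%:R by rewrite oE natrD.
  have a0 := a_ge0 u v; have a1 := a_le1 u v.
  have o1 : 0 <= (o u v)%:R :> R by rewrite ler0n.
  have o2 : 0 <= (o v u)%:R :> R by rewrite ler0n.
  rewrite /b1 /b2 /b3 /join_rel (a_sym v u).
  have uE w : (w \in E) = (w \notin L) && (w \notin R0) by rewrite inE.
  have uR w : w \in L -> (w \in R0) = false by rewrite inE => ->.
  have [euv|nuv] := eqVneq u v.
    have -> : a u v = 0 by rewrite euv adj_irr.
    move: o1 o2 (uR v); rewrite euv uE.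
    by case: (v \in L) => o1 o2 => [/(_ isT)->|_]; case: (v \in R0) => /=; lra.
  rewrite !uE; move: (uR u) (uR v).
  case: (u \in L) => [/(_ isT)->|_]; case: (v \in L) => [/(_ isT)->|_] /=;
    try case: (u \in R0); try case: (v \in R0); rewrite /=; lra.
have sum_pt : gform G x + 2 * S b1 <= \sum_u \sum_v (join_rel u v)%:R * x u * x v + 2 * S b2 + 2 * S b3.
  have -> : gform G x + 2 * S b1 = gform G x + S b1 + S b1 by ring.
  rewrite -[X in _ + X](symS b1).
  have -> : \sum_u \sum_v (join_rel u v)%:R * x u * x v + 2 * S b2 + 2 * S b3 =
    \sum_u \sum_v (join_rel u v)%:R * x u * x v + S b2 + \sum_u \sum_v b2 v u * x u * x v
      + S b3 + \sum_u \sum_v b3 v u * x u * x v by rewrite !symS; ring.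
  rewrite /gform /S -!big_split /=; apply: ler_sum => u _.
  rewrite -!big_split /=; apply: ler_sum => v _.
  rewrite -!mulrDl -!mulrA; apply: ler_wpM2r; [exact: mulr_ge0|exact: pt].
have SE b (c : 'I_n -> 'I_n -> R) (U : {set 'I_n}) :
    (forall u v, b u v = ((u \in E) && (v \in U))%:R * c u v) ->
    S b = \sum_(u in E) x u * \sum_(v in U) c u v * x v.
  move=> bE; rewrite /S [RHS]big_mkcond /=; apply: eq_bigr => u _.
  case: ifPn => uE; last by rewrite big1 // => v _; rewrite bE (negPf uE) /= !mul0r.
  rewrite mulr_sumr [RHS]big_mkcond /=; apply: eq_bigr => v _; rewrite bE uE /=.
  by case: (v \in U); rewrite ?mul1r ?mul0r //; ring.
(* A vertex of [E] misses some vertex of [L], a gain of [c0]; it has at most one neighbor in [R0]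
   and at most [l] out-neighbors in [E], a loss of at most [delta * (l + 1)]. *)
have h1 : c0 * \sum_(u in E) x u <= S b1.
  rewrite (SE b1 (fun u v => 1 - a u v) L) // mulr_sumr; apply: ler_sum => u.
  rewrite inE => /andP[uL]; rewrite inE uL /= negb_forall => /existsP[v].
  rewrite negb_imply => /andP[vL vu]; rewrite mulrC ler_wpM2l //.
  rewrite (bigD1 v) //= a_sym (negPf vu) subr0 mul1r.
  apply: le_trans (inner_large vL) _; rewrite lerDl sumr_ge0 // => t _.
  by rewrite mulr_ge0 // subr_ge0.
have h2 : S b2 <= delta * \sum_(u in E) x u.
  rewrite (SE b2 (fun u v => a u v) R0) // mulr_sumr; apply: ler_sum => u.
  rewrite inE => /andP[uL _]; rewrite [leRHS]mulrC ler_wpM2l //.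
  apply: le_trans (_ : \sum_(v in R0) a u v * delta <= _).
    apply: ler_sum => v; rewrite inE => /andP[vL _].
    by rewrite ler_wpM2l // outer_small.
  by rewrite -mulr_suml ler_piMl // sum_R0_le1.
have h3 : S b3 <= delta * l%:R * \sum_(u in E) x u.
  rewrite (SE b3 (fun u v => (o u v)%:R) E) // mulr_sumr; apply: ler_sum => u _.
  rewrite [leRHS]mulrC ler_wpM2l //.
  apply: le_trans (_ : \sum_(v in E) (o u v)%:R * delta <= _).
    apply: ler_sum => v; rewrite inE => /andP[vL _].
    by rewrite ler_wpM2l ?ler0n // outer_small.
  by rewrite -mulr_suml mulrC ler_wpM2l // (out_degree_le R o_le).
lra.
Qed.

(** The chain from [r |x|^2] through the joined form and [gform H] to [rH |x|^2 <= r |x|^2]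
    collapses. Hence [E] has weight zero and the transported vector is an eigenvector of [H], so it
    is positive. Then [E] is empty, [f] maps [G] into [H], and equality of the forms leaves no edge
    of [H] uncovered. *)
Lemma extremal_isomorphic p (f : 'I_n -> 'I_n) : (0 < k)%N -> 0 <= delta ->
  delta * (l%:R + 1) * r ^+ 2 < #|R0|%:R ->
  bijective f -> (forall u v, join_rel u v -> adj (S_graph n k p) (f u) (f v)) ->
  rho R (S_graph n k p) <= r -> isomorphic G (S_graph n k p).
Proof.
move=> k_gt0 delta0 dR bf hom rS; have [g fK gK] := bf.
set H := S_graph n k p in hom rS *.
have [rH rHE] : exists rH, rH = rho R H by exists (rho R H).
rewrite -rHE in rS.
have gap : 0 < #|R0|%:R / r ^+ 2 - delta * (l%:R + 1).
  by rewrite subr_gt0 ltr_pdivlMr ?exprn_gt0.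
have ge := join_form_ge delta0.
have join_le : \sum_u \sum_v (join_rel u v)%:R * x u * x v <= gform H (x \o g).
  rewrite /gform [leRHS](reindex f) /=; last by exists g => u _; rewrite ?fK ?gK.
  apply: ler_sum => u _.
  rewrite [leRHS](reindex f) /=; last by exists g => v _; rewrite ?fK ?gK.
  apply: ler_sum => v _; rewrite !fK -!mulrA; apply: ler_wpM2r.
    by rewrite mulr_ge0.
  by rewrite ler_nat; have := hom u v; case: (join_rel u v) => // ->.
have GE := eigen_gform eig.
have sE_ge0 : 0 <= \sum_(u in E) x u by apply: sumr_ge0.
have sx_ge0 : 0 <= \sum_u x u ^+ 2 by apply: sumr_ge0 => u _; apply: sqr_ge0.
have gH_le := gform_le H (x \o g); rewrite (sum_sqr_cancel _ fK gK) -rHE in gH_le.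
have rSx : rH * \sum_u x u ^+ 2 <= r * \sum_u x u ^+ 2 by rewrite ler_wpM2r.
have pE : 0 <= 2 * (#|R0|%:R / r ^+ 2 - delta * (l%:R + 1)) * \sum_(u in E) x u.
  by rewrite !mulr_ge0 // ltW.
have gHE : rH * (\sum_u (x \o g) u ^+ 2) <= gform H (x \o g).
  rewrite (sum_sqr_cancel _ fK gK); lra.
have sumE0 : 2 * (#|R0|%:R / r ^+ 2 - delta * (l%:R + 1)) * \sum_(u in E) x u = 0 by lra.
have gGH : gform G x = gform H (x \o g) by lra.
have rHr : rH = r.
  have : 0 < \sum_u x u ^+ 2 by apply: sum_sqr_gt0; exists z; rewrite xz.
  move=> sx; apply/le_anti; rewrite rS /=.
  by rewrite -(ler_pM2r sx) -GE gGH.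
have pos : forall u, 0 < (x \o g) u.
  have e2 : 0 < rho R H by rewrite -rHE rHr.
  rewrite rHE in gHE; have e1 := gform_eq gHE.
  have e3 : exists u, 0 < (x \o g) u by exists (f z); rewrite /= fK xz.
  exact: (S_eigenvector_gt0 k_gt0 e2 (fun u => x_ge0 (g u)) e3 e1).
have xpos u : 0 < x u by rewrite -[u]fK; apply: pos.
have E0 u : u \notin E.
  apply/negP => uE; have : 0 < \sum_(u in E) x u.
    by rewrite (bigD1 u) //= ltr_pwDl // sumr_ge0.
  move=> h; have : 0 < 2 * (#|R0|%:R / r ^+ 2 - delta * (l%:R + 1)) * \sum_(u in E) x u.
    by rewrite !mulr_gt0.
  by rewrite sumE0 ltxx.
have homG u v : adj G u v -> adj H (f u) (f v).
  move=> uv; apply: hom; rewrite /join_rel (adj_neq uv) /=.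
  have := E0 u; have := E0 v; rewrite ![_ \in E]inE uv andbT.
  by case: (u \in L) => //; case: (v \in L) => //=; rewrite !negbK => -> ->.
exists f => // u v; apply/idP/idP; first exact: homG.
have : \sum_u \sum_v ((adj H (f u) (f v))%:R - a u v) * x u * x v = 0.
  have -> : \sum_u \sum_v ((adj H (f u) (f v))%:R - a u v) * x u * x v =
     gform H (x \o g) - gform G x.
    rewrite /gform [X in X - _](reindex f) /=; last by exists g => w _; rewrite ?fK ?gK.
    rewrite -sumrB; apply: eq_bigr => w _.
    rewrite [X in X - _](reindex f) /=; last by exists g => t _; rewrite ?fK ?gK.
    rewrite -sumrB; apply: eq_bigr => t _; rewrite !fK; ring.
  by rewrite gGH subrr.
have term_ge0 u' v' : 0 <= ((adj H (f u') (f v'))%:R - a u' v') * x u' * x v'.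
  rewrite !mulr_ge0 // subr_ge0 ler_nat; have := homG u' v'.
  by case: (adj G u' v') => // ->.
move=> /(psumr_eq0P (fun u _ => sumr_ge0 _ (fun v _ => term_ge0 u v))) /(_ u isT).
move=> /(psumr_eq0P (fun v _ => term_ge0 u v)) /(_ v isT) /eqP.
rewrite !mulf_eq0 !(gt_eqF (xpos _)) !orbF subr_eq0 eqr_nat.
by case: (adj G u v) => // /eqP; case: (adj H _ _).
Qed.

End Comparison.

(** * Vertices of large degree *)

Lemma weighted_CauchySchwarz (R : realDomainType) (I : finType) (P : pred I) (c z : I -> R) :
  (forall i, 0 <= c i)%R ->
  ((\sum_(i | P i) c i * z i) ^+ 2 <=
   (\sum_(i | P i) c i) * (\sum_(i | P i) c i * z i ^+ 2))%R.
Proof.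
move=> c_ge0.
have h : (0 <= \sum_(i | P i) \sum_(j | P j) c i * c j * (z i - z j) ^+ 2)%R.
  by apply: sumr_ge0 => i _; apply: sumr_ge0 => j _;
    rewrite mulr_ge0 ?sqr_ge0 ?mulr_ge0 ?c_ge0.
have e : (\sum_(i | P i) \sum_(j | P j) c i * c j * (z i - z j) ^+ 2 =
    (\sum_(i | P i) c i * z i ^+ 2) * (\sum_(i | P i) c i)
    + (\sum_(i | P i) c i) * (\sum_(i | P i) c i * z i ^+ 2)
    - 2 * ((\sum_(i | P i) c i * z i) * (\sum_(i | P i) c i * z i)))%R.
  rewrite !big_distrlr /= mulr_sumr -sumrN -!big_split /=; apply: eq_bigr => i _.
  rewrite mulr_sumr -sumrN -!big_split /=; apply: eq_bigr => j _; ring.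
rewrite e in h; rewrite expr2; move: h.
set a1 := (\sum_(i | P i) c i * z i ^+ 2)%R; set a2 := (\sum_(i | P i) c i)%R.
rewrite [(a1 * a2)%R]mulrC; lra.
Qed.

Section Arithmetic.
Local Open Scope ring_scope.

(** For [q = k], [g = gam] and [t] the weight of the vertices of large degree. Up to terms in [g],
    the first hypothesis reads [q / 2 <= 2 q t], that is [t >= 1 / 4]; the value [1 / 20] leaves
    room for the errors. *)
Lemma upper_weight_bound (R : realFieldType) (g q t : R) :
  (1 / 2 - g) * (q - g) <= 2 * ((q + g) * t) -> g <= 1 / 400 -> 0 < g ->
  1 <= q -> 0 <= t -> 1 / 20 <= t.
Proof.
move=> h g1 g0 q1 t0; rewrite leNgt; apply/negP => t1.
have : g * q <= 1 / 400 * q by rewrite ler_wpM2r //; lra.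
have : q * t <= q * (1 / 20) by rewrite ler_wpM2l //; lra.
have : g * t <= 1 / 400 * (1 / 20) by rewrite ler_pM //; lra.
have := sqr_ge0 g; lra.
Qed.

(** For [q = k], [g = gam], [e = eps]. The coefficient [q - 1 / 2] in place of [q] costs [s / 2],
    while the errors [22 q g s] and [2 q^2 t] together stay below [0.3 s]. *)
Lemma lower_weight_absurd (R : realFieldType) (g q s t e : R) :
  s * q * (1 - 21 * g) <= g * s + (q - 1 / 2) * (s + 2 * q * t) ->
  e * t <= 22 * g * s -> 1 / 20 <= s -> 200 * q ^+ 2 * g <= e -> e <= 1 / 2 ->
  0 < e -> 0 < g -> 1 <= q -> 0 <= t -> False.
Proof.
move=> Y2 tu sl gl el e0 g0 q1 t0.
have q2 : 0 < q ^+ 2 by rewrite exprn_gt0 //; lra.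
have h1 : 200 * q ^+ 2 * t <= 22 * s.
  rewrite -(ler_pM2l e0).
  have : 22 * (200 * q ^+ 2 * g) * s <= 22 * e * s by rewrite ler_wpM2r //; lra.
  have : 200 * q ^+ 2 * (e * t) <= 200 * q ^+ 2 * (22 * g * s).
    by rewrite ler_wpM2l // mulr_ge0 // ltW.
  lra.
have h2 : s / 2 <= 22 * (q * g * s) + 2 * (q ^+ 2 * t).
  have : 0 <= q * t by rewrite mulr_ge0 //; lra.
  have : g * s <= q * (g * s) by rewrite ler_peMl // mulr_ge0; lra.
  lra.
have h3 : 200 * (q * g) <= 1 / 2.
  have : q * g <= q * (q * g) by rewrite ler_peMl // mulr_ge0; lra.
  lra.
have h4 : 200 * (q * g) * s <= 1 / 2 * s by rewrite ler_wpM2r //; lra.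
lra.
Qed.

End Arithmetic.

Section LargeDegree.
Variables (R : realType) (n k l M K : nat) (G : sgraph 'I_n).
Variables (o : rel 'I_n) (x : 'I_n -> R) (r eps tau : R).
Local Open Scope ring_scope.
Local Notation a u v := ((adj G u v)%:R : R).

Let deg u : R := \sum_v a u v.
(** Two thresholds: [D] has boundedly many vertices, yet the edges outside it are negligible; [L]
    contains the vertices adjacent to almost everything. The error [gam] adds [(l + 2) tau] from the
    pairs outside [D] and [tau] from the pairs inside [D]. *)
Let D := [set u | tau ^+ 2 * n%:R <= deg u].
Let L := [set u | (1 - eps) * n%:R <= deg u].
Let gam := (l%:R + 3) * tau.

(** Union bound: a vertex that is not a common neighbor is missed by some vertex of [Q]. *)
Lemma common_neighbors_ge (Q : {set 'I_n}) (d : R) :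
  {in Q, forall u, n%:R - d <= deg u} ->
  n%:R <= #|[set v | [forall u in Q, adj G u v]]|%:R + #|Q|%:R * d.
Proof.
move=> degQ.
have pt v : 1 <= ([forall u in Q, adj G u v])%:R + \sum_(u in Q) (1 - a u v).
  case: (boolP [forall u in Q, adj G u v]) => [_|].
    by rewrite lerDl sumr_ge0 // => u _; rewrite subr_ge0; case: (adj G u v).
  rewrite negb_forall => /existsP[u]; rewrite negb_imply => /andP[uQ uv].
  rewrite add0r (bigD1 u) //= (negPf uv) subr0 lerDl sumr_ge0 // => w _.
  by rewrite subr_ge0; case: (adj G w v).
apply: le_trans (_ : \sum_v (([forall u in Q, adj G u v])%:R + \sum_(u in Q) (1 - a u v)) <= _).
  apply: le_trans (_ : \sum_(v : 'I_n) 1 <= _); last by apply: ler_sum => v _.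
  by rewrite sumr_const card_ord.
rewrite big_split /= sum_bool_card cardsE lerD2l exchange_big /=.
apply: le_trans (_ : \sum_(u in Q) d <= _); last by rewrite sumr_const mulr_natl.
apply: ler_sum => u uQ; rewrite sumrB sumr_const card_ord -/(deg u).
have := degQ u uQ; rewrite -[X in X - _ <= d]/(n%:R); lra.
Qed.

Hypothesis n_gt0 : (0 < n)%N.
Hypothesis k_gt0 : (0 < k)%N.
Hypothesis oE : forall u v, (adj G u v = o u v + o v u :> nat)%N.
Hypothesis o_le : forall u, (#|[set v | o u v]| <= l)%N.
Hypothesis x_ge0 : forall u, 0 <= x u.
Hypothesis x_norm : \sum_u x u ^+ 2 = 1.
Hypothesis r_gt0 : 0 < r.
Hypothesis eig : forall u, \sum_v a u v * x v = r * x u.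
Hypothesis forbid : forall Q : {set 'I_n}, (k < #|Q|)%N ->
  (#|[set v | [forall u in Q, adj G u v]]| <= M)%N.
Hypothesis tau_gt0 : 0 < tau.
Hypothesis n_le : n%:R <= 2 * r ^+ 2.
Hypothesis r_ge : (k%:R - gam) * n%:R <= r ^+ 2.
Hypothesis K_ge : 2 * l%:R <= K%:R * tau ^+ 2.
Hypothesis K_le : K%:R <= tau * r.
Hypothesis exc_le : (2 ^ K * M * K)%:R <= gam * n%:R.

Let a_ge0 u v : 0 <= a u v. Proof. exact: ler0n. Qed.
Let a_le1 u v : a u v <= 1. Proof. by case: (adj G u v). Qed.
Let a_sym u v : a u v = a v u. Proof. by rewrite adj_sym. Qed.
Let nR_gt0 : 0 < n%:R :> R. Proof. by rewrite ltr0n. Qed.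
Let deg_le u : deg u <= n%:R.
Proof.
apply: le_trans (_ : \sum_(v : 'I_n) 1 <= _); last by rewrite sumr_const card_ord.
exact: ler_sum.
Qed.
Let l_ge0 : 0 <= l%:R :> R. Proof. exact: ler0n. Qed.
Let gam_gt0 : 0 < gam. Proof. by rewrite mulr_gt0 // ltr_wpDl. Qed.

Let sumD (f : 'I_n -> R) : \sum_u f u = \sum_(u in D) f u + \sum_(u | u \notin D) f u.
Proof. exact: (bigID (mem D)). Qed.

Lemma card_D : (#|D| <= K)%N.
Proof.
rewrite -(ler_nat R) -(ler_pM2r (mulr_gt0 (exprn_gt0 2 tau_gt0) nR_gt0)).
apply: le_trans (_ : \sum_(u in D) deg u <= _).
  rewrite mulr_natl -sumr_const; apply: ler_sum => u; by rewrite inE.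
apply: le_trans (_ : 2 * l%:R * n%:R <= _); last by rewrite mulrA ler_wpM2r.
have := arcs_le R oE o_le [set: 'I_n]; rewrite cardsT card_ord; apply: le_trans.
rewrite [leRHS](eq_bigl xpredT) => [|u]; last by rewrite inE.
rewrite (sumD (fun u => \sum_(v in [set: 'I_n]) a u v)) -[leLHS]addr0 lerD //.
  by apply: ler_sum => u _; rewrite /deg [leRHS](eq_bigl xpredT) // => v; rewrite inE.
by apply: sumr_ge0 => u _; apply: sumr_ge0.
Qed.

Let s := \sum_(u in D) x u ^+ 2.
Let y v := \sum_(u in D) a v u * x u.
Let Y := \sum_(v | v \notin D) y v ^+ 2.

Let s_ge0 : 0 <= s. Proof. by apply: sumr_ge0 => u _; apply: sqr_ge0. Qed.
Let sC : \sum_(u | u \notin D) x u ^+ 2 = 1 - s.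
Proof. by have := x_norm; rewrite (sumD (fun u => x u ^+ 2)) -/s; lra. Qed.

Let s_le1 : s <= 1.
Proof. by rewrite -subr_ge0 -sC sumr_ge0 // => u _; apply: sqr_ge0. Qed.

Lemma form_DD : \sum_(u in D) \sum_(v in D) a u v * x u * x v <= K%:R.
Proof.
apply: le_trans (_ : (\sum_(u in D) 1 * x u) ^+ 2 <= _).
  rewrite expr2 big_distrlr /=; apply: ler_sum => u _; apply: ler_sum => v _.
  by rewrite !mul1r -mulrA ler_piMl // mulr_ge0.
apply: le_trans (weighted_CauchySchwarz _ _ _) _ => //.
under [X in _ * X]eq_bigr do rewrite mul1r.
by rewrite sumr_const -[leRHS]mulr1 ler_pM ?ler0n ?s_ge0 ?s_le1 // ler_nat card_D.
Qed.

(** On an arc from [u] to [v], [2 x_u x_v <= tau r x_u^2 + x_v^2 / (tau r)]. The first term is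
    summed over at most [l] out-neighbors, the second over at most [tau^2 n <= 2 tau^2 r^2]
    in-neighbors. *)
Lemma form_CC : \sum_(u | u \notin D) \sum_(v | v \notin D) a u v * x u * x v <=
  (l%:R + 2) * tau * r.
Proof.
have tr : 0 < tau * r by rewrite mulr_gt0.
have -> : \sum_(u | u \notin D) \sum_(v | v \notin D) a u v * x u * x v =
    \sum_(u | u \notin D) \sum_(v | v \notin D) (o u v)%:R * (2 * x u * x v).
  have -> : \sum_(u | u \notin D) \sum_(v | v \notin D) a u v * x u * x v =
      \sum_(u | u \notin D) \sum_(v | v \notin D) (o u v)%:R * (x u * x v) +
      \sum_(u | u \notin D) \sum_(v | v \notin D) (o v u)%:R * (x u * x v).
    rewrite -big_split /=; apply: eq_bigr => u _; rewrite -big_split /=.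
    by apply: eq_bigr => v _; rewrite oE natrD; ring.
  rewrite [X in _ + X]exchange_big /= -big_split /=; apply: eq_bigr => u _.
  by rewrite -big_split /=; apply: eq_bigr => v _; ring.
apply: le_trans (_ : \sum_(u | u \notin D) \sum_(v | v \notin D)
   ((o u v)%:R * (tau * r * x u ^+ 2) + (o u v)%:R * (x v ^+ 2 / (tau * r))) <= _).
  apply: ler_sum => u _; apply: ler_sum => v _; rewrite -mulrDr ler_wpM2l ?ler0n //.
  rewrite -subr_ge0.
  have -> : tau * r * x u ^+ 2 + x v ^+ 2 / (tau * r) - 2 * x u * x v =
     (tau * r * x u - x v) ^+ 2 / (tau * r).
    by field; rewrite !gt_eqF.
  by rewrite divr_ge0 ?sqr_ge0 // ltW.
under eq_bigr do rewrite big_split /=; rewrite big_split /= !mulrDl lerD //.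
  apply: le_trans (_ : \sum_(u | u \notin D) l%:R * (tau * r * x u ^+ 2) <= _).
    apply: ler_sum => u _; rewrite -mulr_suml ler_wpM2r //.
      by rewrite mulr_ge0 ?sqr_ge0 // ltW.
    have := out_degree_le R o_le u (~: D); apply: le_trans.
    by rewrite (eq_bigl (fun v => v \in ~: D)) // => v; rewrite in_setC.
  rewrite -!mulr_sumr sC -!mulrA ler_wpM2l // !mulrA ler_piMr ?(ltW tr) //.
  by rewrite lerBlDr lerDl.
rewrite exchange_big /=.
apply: le_trans (_ : \sum_(v | v \notin D) (2 * tau * r) * x v ^+ 2 <= _); last first.
  rewrite -mulr_sumr sC; have := mulr_ge0 (ltW tr) s_ge0; lra.
apply: ler_sum => v vD; rewrite -mulr_suml.
have dv : \sum_(u | u \notin D) (o u v)%:R <= tau ^+ 2 * n%:R :> R.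
  apply: le_trans (_ : deg v <= _).
    apply: le_trans (_ : \sum_u (o u v)%:R <= _).
      by apply: ler_sum_subset => // u _; rewrite ler0n.
    apply: ler_sum => u _; rewrite ler_nat oE leq_addl //.
  by move: vD; rewrite inE -ltNge => /ltW.
rewrite mulrCA mulrC; apply: ler_wpM2r; first exact: sqr_ge0.
rewrite ler_pdivrMr //; apply: le_trans dv _.
have -> : 2 * tau * r * (tau * r) = tau ^+ 2 * (2 * r ^+ 2) by ring.
by rewrite ler_wpM2l // exprn_ge0 // ltW.
Qed.

Lemma form_DC : (1 - gam) * r <= 2 * \sum_(v | v \notin D) x v * y v.
Proof.
have gE := eigen_gform eig; rewrite x_norm mulr1 in gE.
have e : gform G x = \sum_(u in D) \sum_(v in D) a u v * x u * x v +
   2 * (\sum_(v | v \notin D) x v * y v) +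
   \sum_(u | u \notin D) \sum_(v | v \notin D) a u v * x u * x v.
  have e1 : \sum_(v | v \notin D) x v * y v =
      \sum_(u | u \notin D) \sum_(v in D) a u v * x u * x v.
    by apply: eq_bigr => u _; rewrite mulr_sumr; apply: eq_bigr => v _; ring.
  have e2 : \sum_(v | v \notin D) x v * y v =
      \sum_(u in D) \sum_(v | v \notin D) a u v * x u * x v.
    rewrite e1 exchange_big /=; apply: eq_bigr => u _; apply: eq_bigr => v _.
    rewrite a_sym; ring.
  rewrite /gform sumD.
  under eq_bigr do rewrite sumD; rewrite big_split /= -e2.
  under [X in _ + X]eq_bigr do rewrite sumD.
  rewrite [X in _ + X]big_split /= -e1; ring.
have := form_DD; have := form_CC; rewrite e in gE.
rewrite /gam; move: K_le gE; lra.
Qed.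

(** From [2 x_v y_v <= c x_v^2 + y_v^2 / c]. The parameter stays free because two values of it are
    used. *)
Lemma Y_lower c : 0 < c -> (1 - gam) * r <= c * (1 - s) + Y / c.
Proof.
move=> c_gt0; apply: le_trans form_DC _.
rewrite -sC /Y !mulr_sumr mulr_suml -big_split /=; apply: ler_sum => v _.
rewrite -subr_ge0.
have -> : c * x v ^+ 2 + y v ^+ 2 / c - 2 * (x v * y v) = (c * x v - y v) ^+ 2 / c.
  by field; rewrite gt_eqF.
by rewrite divr_ge0 ?sqr_ge0 // ltW.
Qed.

Let N v := [set u in D | adj G v u].
Let X := [set v | (k < #|N v|)%N].

(** The vertices of [X] are sorted by their neighborhood in [D]; each of the at most [2 ^ K] sets
    larger than [k] has at most [M] common neighbors. *)
Lemma card_exceptional : (#|X| <= 2 ^ K * M)%N.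
Proof.
rewrite -sum1_card (partition_big N (fun Q => Q \in powerset D)) /=; last first.
  by move=> v _; rewrite powersetE; apply/subsetP => u; rewrite inE => /andP[].
apply: leq_trans (_ : (\sum_(Q in powerset D) M <= _)%N).
  apply: leq_sum => Q _; rewrite sum1dep_card.
  have [kQ|kQ] := ltnP k #|Q|.
    apply: leq_trans (forbid kQ); apply: subset_leq_card; apply/subsetP => v.
    rewrite !inE => /andP[_ /eqP<-]; apply/forallP => u; apply/implyP.
    by rewrite inE adj_sym => /andP[].
  rewrite (_ : [set _ | _] = set0) ?cards0 //; apply/setP => v; rewrite !inE.
  by apply/negP => /andP[h /eqP e]; rewrite e ltnNge kQ in h.
rewrite sum_nat_const card_powerset leq_mul2r leq_pexp2l ?orbT //.
exact: card_D.
Qed.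

Lemma sum_N v : \sum_(u in D) a v u = #|N v|%:R.
Proof.
have -> : \sum_(u in D) a v u = \sum_u ((u \in D) && adj G v u)%:R.
  by rewrite big_mkcond /=; apply: eq_bigr => u _; case: (u \in D).
by rewrite sum_bool_card /N cardsE.
Qed.

Lemma y_sqr_le v : y v ^+ 2 <= #|N v|%:R * \sum_(u in D) a v u * x u ^+ 2.
Proof.
apply: le_trans (weighted_CauchySchwarz _ _ _) _ => //.
by rewrite sum_N.
Qed.

Let ax_le v : \sum_(u in D) a v u * x u ^+ 2 <= s.
Proof. by apply: ler_sum => u _; rewrite ler_piMl ?sqr_ge0. Qed.

(** Each exceptional vertex contributes at most [K s], and [exc_le] absorbs their total into
    [gam n s]. *)
Lemma Y_upper (B : 'I_n -> R) : (forall v, 0 <= B v) ->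
  (forall v, v \notin X -> y v ^+ 2 <= B v) -> Y <= gam * n%:R * s + \sum_v B v.
Proof.
move=> B_ge0 yB.
apply: le_trans (_ : \sum_v ((v \in X)%:R * (K%:R * s) + B v) <= _).
  apply: le_trans (_ : \sum_(v | v \notin D) ((v \in X)%:R * (K%:R * s) + B v) <= _).
    apply: ler_sum => v _; have [vX|vX] := boolP (v \in X); last first.
      by rewrite mul0r add0r yB.
    rewrite mul1r; apply: le_trans (y_sqr_le v) _; rewrite -[leLHS]addr0 lerD //.
    rewrite ler_pM ?ler0n ?ler_nat //; last first.
      apply: leq_trans card_D; apply: subset_leq_card; apply/subsetP => u.
      by rewrite inE => /andP[].
    by apply: sumr_ge0 => u _; rewrite mulr_ge0 ?sqr_ge0.
  apply: ler_sum_subset => // v _.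
  by rewrite addr_ge0 // !mulr_ge0 ?ler0n.
rewrite big_split /= lerD2r -mulr_suml sum_bool_card mulrA ler_wpM2r //.
apply: le_trans exc_le; rewrite -natrM ler_nat leq_mul2r.
by have := card_exceptional; rewrite (_ : #|fun v => v \in X| = #|X|) // => ->; rewrite orbT.
Qed.

Lemma sum_NX : Y <= gam * n%:R * s + k%:R * \sum_(u in D) deg u * x u ^+ 2.
Proof.
have -> : k%:R * \sum_(u in D) deg u * x u ^+ 2 =
    \sum_v k%:R * \sum_(u in D) a v u * x u ^+ 2.
  rewrite -mulr_sumr exchange_big /=; congr (_ * _); apply: eq_bigr => u _.
  by rewrite -mulr_suml /deg; congr (_ * _); apply: eq_bigr => v _; rewrite a_sym.
have h v : 0 <= \sum_(u in D) a v u * x u ^+ 2.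
  by apply: sumr_ge0 => u _; rewrite mulr_ge0 ?sqr_ge0.
apply: Y_upper => [v|v vX]; first by rewrite mulr_ge0 ?ler0n.
apply: le_trans (y_sqr_le v) _; rewrite ler_wpM2r // ler_nat leqNgt.
by rewrite inE in vX.
Qed.

Hypothesis eps_gt0 : 0 < eps.
Hypothesis eps_le : eps <= 1 / 2.
Hypothesis tau_le : tau ^+ 2 <= 1 / 2.
Hypothesis gam_le : 200 * k%:R ^+ 2 * gam <= eps.

Let k_ge1 : 1 <= k%:R :> R. Proof. by rewrite ler1n. Qed.

Let gam_small : gam <= 1 / 400.
Proof.
have : 1 <= k%:R ^+ 2 :> R by rewrite exprn_ege1.
move: gam_le gam_gt0 eps_le; nra.
Qed.

Let LD : {subset L <= D}.
Proof.
move=> u; rewrite !inE; apply: le_trans; rewrite ler_wpM2r ?ler0n //.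
by move: eps_le tau_le; lra.
Qed.

(** Taking [c = r / 2] leaves at least [(1 / 2 - gam) r^2 <= 2 Y], whereas [Y] is at most about
    [k n s]. The choice [c = r] would be compatible with [s = 0]. *)
Lemma s_lower : 1 / 20 <= s.
Proof.
have r2 : 0 < r / 2 by rewrite divr_gt0.
have := ler_wpM2r (ltW r_gt0) (Y_lower r2).
have -> : (r / 2 * (1 - s) + Y / (r / 2)) * r = r ^+ 2 / 2 * (1 - s) + 2 * Y.
  by field; rewrite gt_eqF.
have Yle : Y <= (k%:R + gam) * n%:R * s.
  apply: le_trans sum_NX _; rewrite mulrDl mulrDl addrC lerD2r -mulrA ler_wpM2l ?ler0n //.
  by rewrite mulr_sumr; apply: ler_sum => u _; rewrite ler_wpM2r ?sqr_ge0.
move=> h.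
have h1 : (1 / 2 - gam) * r ^+ 2 <= 2 * ((k%:R + gam) * n%:R * s).
  have : r ^+ 2 / 2 * (1 - s) <= r ^+ 2 / 2.
    by rewrite ler_piMr ?lerBlDr ?lerDl // divr_ge0 ?sqr_ge0.
  move: h Yle; rewrite expr2; lra.
have h2 : (1 / 2 - gam) * ((k%:R - gam) * n%:R) <= 2 * ((k%:R + gam) * n%:R * s).
  apply: le_trans h1; rewrite ler_wpM2l //; move: gam_small; lra.
have h3 : (1 / 2 - gam) * (k%:R - gam) <= 2 * ((k%:R + gam) * s).
  rewrite -(ler_pM2r nR_gt0); move: h2; lra.
exact: (upper_weight_bound h3 gam_small gam_gt0 k_ge1 s_ge0).
Qed.

(** Now [c = r] gives the sharp constant. Of the 21, 20 come from writing [gam <= 20 gam s], and 1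
    from the error in [r_ge]. *)
Lemma Y_ge : s * n%:R * k%:R * (1 - 21 * gam) <= Y.
Proof.
have := ler_wpM2r (ltW r_gt0) (Y_lower r_gt0).
have -> : (r * (1 - s) + Y / r) * r = r ^+ 2 * (1 - s) + Y.
  by field; rewrite gt_eqF.
move=> h; have h1 : (s - gam) * r ^+ 2 <= Y by move: h; rewrite expr2; lra.
have sl := s_lower; have gs := gam_small; have g0 := gam_gt0.
have h2 : s * (1 - 20 * gam) * ((k%:R - gam) * n%:R) <= Y.
  apply: le_trans h1.
  have h3 : 0 <= s * (1 - 20 * gam) by rewrite mulr_ge0 //; lra.
  have h4 : s * (1 - 20 * gam) <= s - gam by nra.
  apply: le_trans (ler_wpM2l h3 r_ge) _.
  by rewrite ler_wpM2r // sqr_ge0.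
apply: le_trans h2.
have -> : s * (1 - 20 * gam) * ((k%:R - gam) * n%:R) = s * n%:R * ((1 - 20 * gam) * (k%:R - gam)) by ring.
rewrite -[leLHS]mulrA ler_wpM2l ?mulr_ge0 ?ler0n //.
have := mulr_ge0 (ltW g0) (ltW g0); have : gam <= gam * k%:R by rewrite ler_peMr // ltW.
lra.
Qed.

Let t := \sum_(u in D | u \notin L) x u ^+ 2.

Let sumDL (f : 'I_n -> R) :
  \sum_(u in D) f u = \sum_(u in L) f u + \sum_(u in D | u \notin L) f u.
Proof.
rewrite (bigID (mem L)) /=; congr (_ + _); apply: eq_bigl => u.
by apply/andP/idP => [[]//|uL]; split=> //; apply: LD.
Qed.

(** A vertex of [D] outside [L] lacks [eps n] neighbors, which lowers the bound of [sum_NX] by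
    [k n eps t]; this loss must fit into the gap left by [Y_ge]. *)
Lemma t_upper : eps * t <= 22 * gam * s.
Proof.
have Yu := le_trans Y_ge sum_NX.
have h : \sum_(u in D) deg u * x u ^+ 2 <= n%:R * (s - eps * t).
  rewrite /s !sumDL -/t.
  have -> : n%:R * (\sum_(u in L) x u ^+ 2 + t - eps * t) =
     \sum_(u in L) n%:R * x u ^+ 2 + (1 - eps) * n%:R * t.
    by rewrite -mulr_sumr; ring.
  rewrite lerD //; first by apply: ler_sum => u _; rewrite ler_wpM2r ?sqr_ge0.
  rewrite mulr_sumr; apply: ler_sum => u /andP[_]; rewrite inE -ltNge => /ltW.
  by move=> ?; rewrite ler_wpM2r ?sqr_ge0.
have h' : s * n%:R * k%:R * (1 - 21 * gam) <= gam * n%:R * s + k%:R * (n%:R * (s - eps * t)).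
  by apply: le_trans Yu _; rewrite lerD2l ler_wpM2l ?ler0n.
have h2 : k%:R * (eps * t) <= 21 * (gam * s * k%:R) + gam * s.
  rewrite -(ler_pM2l nR_gt0); move: h'; lra.
have h3 : gam * s <= gam * s * k%:R by rewrite ler_peMr // mulr_ge0 // ltW.
have : k%:R * (eps * t) <= k%:R * (22 * gam * s) by lra.
by rewrite ler_pM2l // ltr0n.
Qed.

Lemma card_L_ge : (k <= #|L|)%N.
Proof.
rewrite leqNgt; apply/negP => Lk.
(* With these weights the first factor in the Cauchy-Schwarz inequality is at most
   [(k - 1) + k / (2 k) = k - 1 / 2], strictly below [k]. The price is the factor [2 k] on the
   weight [t], which is tiny by [t_upper]. *)
pose w u : R := if u \in L then 1 else 1 / (2 * k%:R).
have k2 : 0 < 2 * k%:R :> R by rewrite mulr_gt0 // ltr0n.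
have w_gt0 u : 0 < w u by rewrite /w; case: ifP => _ //; rewrite divr_gt0.
have t_ge0 : 0 <= t by apply: sumr_ge0 => u _; apply: sqr_ge0.
have q0 : 0 <= k%:R - 1 / 2 :> R by move: k_ge1; lra.
have Yu : Y <= gam * n%:R * s + \sum_(v : 'I_n) (k%:R - 1 / 2) * (s + 2 * k%:R * t).
  apply: Y_upper => [v|v vX].
    by rewrite mulr_ge0 // addr_ge0 // mulr_ge0 // ltW.
  have -> : y v = \sum_(u in D) a v u * w u * (x u / w u).
    by apply: eq_bigr => u _; rewrite -mulrA; congr (_ * _); field; rewrite gt_eqF.
  apply: le_trans (weighted_CauchySchwarz _ _ _) _ => [u|].
    by rewrite mulr_ge0 // ltW.
  apply: ler_pM.
  - by apply: sumr_ge0 => u _; rewrite mulr_ge0 // ltW.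
  - by apply: sumr_ge0 => u _; rewrite mulr_ge0 ?sqr_ge0 // mulr_ge0 // ltW.
  - rewrite sumDL.
    apply: le_trans (_ : (k%:R - 1) + 1 / 2 <= _); last by lra.
    apply: lerD.
      apply: le_trans (_ : \sum_(u in L) 1 <= _).
        by apply: ler_sum => u uL; rewrite /w uL mulr1.
      by rewrite sumr_const lerBrDr natr1 ler_nat.
    apply: le_trans (_ : \sum_(u in D | u \notin L) a v u * (1 / (2 * k%:R)) <= _).
      by apply: ler_sum => u /andP[_ uL]; rewrite /w (negPf uL).
    rewrite -mulr_suml.
    apply: le_trans (_ : k%:R * (1 / (2 * k%:R)) <= _).
      rewrite ler_wpM2r ?divr_ge0 ?(ltW k2) //.
      apply: le_trans (_ : \sum_(u in D) a v u <= _).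
        by apply: ler_sum_subset => // u /andP[].
      by rewrite sum_N ler_nat leqNgt; rewrite inE in vX.
    have -> : k%:R * (1 / (2 * k%:R)) = 1 / 2 :> R by field; rewrite gt_eqF // ltr0n.
    by [].
  - rewrite sumDL lerD //.
      apply: le_trans (_ : \sum_(u in L) x u ^+ 2 <= _).
        apply: ler_sum => u uL; rewrite /w uL divr1 mulr1.
        by rewrite ler_piMl ?sqr_ge0.
      by apply: ler_sum_subset => [u /LD//|u _]; apply: sqr_ge0.
    rewrite mulr_sumr; apply: ler_sum => u /andP[_ uL]; rewrite /w (negPf uL).
    have -> : a v u * (1 / (2 * k%:R)) * (x u / (1 / (2 * k%:R))) ^+ 2 =
        a v u * (2 * k%:R * x u ^+ 2).
      by field; rewrite gt_eqF // ltr0n.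
    by rewrite ler_piMl // mulr_ge0 ?sqr_ge0 // ltW.
rewrite sumr_const card_ord in Yu.
have Y1 : s * n%:R * k%:R * (1 - 21 * gam) <=
    gam * n%:R * s + n%:R * ((k%:R - 1 / 2) * (s + 2 * k%:R * t)).
  by apply: le_trans Y_ge _; apply: le_trans Yu _; rewrite [n%:R * (_ * _)]mulr_natl.
have Y2 : s * k%:R * (1 - 21 * gam) <= gam * s + (k%:R - 1 / 2) * (s + 2 * k%:R * t).
  rewrite -(ler_pM2l nR_gt0); move: Y1; lra.
have tu := t_upper; have sl := s_lower; have gs := gam_small.
have gl := gam_le; have el := eps_le; have e0 := eps_gt0; have g0 := gam_gt0.
exact: (lower_weight_absurd Y2 tu sl gl el e0 g0 k_ge1 t_ge0).
Qed.

(** If [L] had [k + 1] vertices, these would have at least [n / 2 > M] common neighbors. *)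
Lemma large_degree_card : (k.+1)%:R * eps <= 1 / 2 -> 2 * M%:R < n%:R :> R -> #|L| = k.
Proof.
move=> keps Mn; apply/eqP; rewrite eqn_leq card_L_ge andbT leqNgt; apply/negP => kL.
pose Q := [set u in take k.+1 (enum L)].
have cQ : #|Q| = k.+1.
  rewrite cardsE (card_uniqP _) ?take_uniq ?enum_uniq // size_takel // -cardE //.
have := @common_neighbors_ge Q (eps * n%:R).
rewrite cQ => h; have {}h : n%:R <= #|[set v | [forall u in Q, adj G u v]]|%:R + k.+1%:R * (eps * n%:R).
  apply: h => u; rewrite inE => /mem_take; rewrite mem_enum inE; lra.
have : (#|[set v | [forall u in Q, adj G u v]]|%:R : R) <= M%:R.
  by rewrite ler_nat forbid // cQ.
have : k.+1%:R * eps * n%:R <= 1 / 2 * n%:R by rewrite ler_wpM2r ?ler0n.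
lra.
Qed.

End LargeDegree.

(** * Uniqueness of the extremal graph *)

Section Uniqueness.
Local Open Scope ring_scope.

Section Normalization.
Variables (R : realType) (n : nat) (G : sgraph 'I_n) (r : R) (x : 'I_n -> R).
Hypothesis x_ge0 : forall u, 0 <= x u.
Hypothesis x_gt0 : exists u, 0 < x u.
Hypothesis eig : forall u, \sum_v (adj G u v)%:R * x v = r * x u.

Let eig_scale (c : R) u : \sum_v (adj G u v)%:R * (x v / c) = r * (x u / c).
Proof. by rewrite mulrA -eig mulr_suml; apply: eq_bigr => v _; rewrite mulrA. Qed.

Lemma normalize_max : exists (y : 'I_n -> R) (z : 'I_n),
  [/\ forall u, 0 <= y u, forall u, y u <= 1, y z = 1 &
      forall u, \sum_v (adj G u v)%:R * y v = r * y u].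
Proof.
have [u0 xu0] := x_gt0.
have [z _ zmax] := @arg_maxP _ _ _ u0 predT x isT.
have xz : 0 < x z by apply: lt_le_trans xu0 (zmax u0 isT).
exists (fun u => x u / x z), z; split => [u|u||u].
- by rewrite divr_ge0.
- by rewrite ler_pdivrMr // mul1r; apply: zmax.
- by rewrite divff // gt_eqF.
- exact: eig_scale.
Qed.

Lemma normalize_sqr : exists y : 'I_n -> R,
  [/\ forall u, 0 <= y u, \sum_u y u ^+ 2 = 1 &
      forall u, \sum_v (adj G u v)%:R * y v = r * y u].
Proof.
have S_gt0 := sum_sqr_gt0 x_gt0; set S := \sum_u _ in S_gt0.
have c_gt0 : 0 < Num.sqrt S by rewrite sqrtr_gt0.
exists (fun u => x u / Num.sqrt S); split => [u||u].
- by rewrite divr_ge0 // ltW.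
- under eq_bigr do rewrite expr_div_n.
  by rewrite -mulr_suml sqr_sqrtr ?(ltW S_gt0) // divff // gt_eqF.
- exact: eig_scale.
Qed.

End Normalization.

(* [R0] is to be thought of as the common neighborhood of the [k] vertices of
   [L]; the vertices in [e] are the ends of the [p] edges inside [R0]. *)
Definition join_config (V : finType) (G : sgraph V) (L R0 : {set V}) (p : nat) : Prop :=
  (forall v u1 u2, v \notin L -> u1 \in R0 -> u2 \in R0 ->
     adj G v u1 -> adj G v u2 -> u1 = u2) /\
  exists e : seq V, [/\ uniq e, {subset e <= R0}, size e = p.*2 &
    {in R0 &, forall u v, adj G u v -> (u \in e) && (v \in e)}].

(** The numerical conditions are hypotheses, which separates the graph theory from the choice of
    constants. Each of the [k] vertices of [L] misses at most [eps n] vertices, whence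
    [#|E| <= k eps n]. *)
Lemma extremal_unique_of_bounds (R : realType) (n k l K p : nat) (G : sgraph 'I_n)
    (T : finType) (F : sgraph T) (A B : {set T}) (x : 'I_n -> R)
    (r eps tau delta : R) :
  (0 < n)%N -> (0 < k)%N -> (p <= 1)%N -> #|T| = l -> is_tree F ->
  partite_sets F A B -> (#|A| <= k.+1)%N -> is_free F G ->
  (forall L R0 : {set 'I_n}, #|L| = k -> [disjoint L & R0] ->
     {in L & R0, forall u v, adj G u v} -> (l.*2 <= #|R0|)%N -> join_config G L R0 p) ->
  (forall u, 0 <= x u) -> (exists u, 0 < x u) ->
  (forall u, \sum_v (adj G u v)%:R * x v = r * x u) -> 0 < r ->
  0 < tau -> n%:R <= 2 * r ^+ 2 ->
  (k%:R - (l%:R + 3) * tau) * n%:R <= r ^+ 2 ->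
  2 * l%:R <= K%:R * tau ^+ 2 -> K%:R <= tau * r ->
  (2 ^ K * l.*2 * K)%:R <= (l%:R + 3) * tau * n%:R ->
  0 < eps -> eps <= 1 / 2 -> tau ^+ 2 <= 1 / 2 ->
  200 * k%:R ^+ 2 * ((l%:R + 3) * tau) <= eps -> (k.+1)%:R * eps <= 1 / 2 ->
  4 * l%:R < n%:R :> R -> 0 <= delta -> delta < 1 ->
  r * k%:R + (k%:R + 2 * l%:R + 2) * (k%:R * eps * n%:R + 1) <= delta * r ^+ 2 ->
  delta * (l%:R + 1) * (2 * l%:R) < 1 / 2 ->
  rho R (S_graph n k p) <= r -> isomorphic G (S_graph n k p).
Proof.
move=> n_gt0 k_gt0 p1 Tl treeF AB Ak freeG config x_ge0 x_gt0 eig r_gt0 tau0 n_le r_ge K_ge K_le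
  exc eps0 eps1 tau1 gam1 keps ln delta0 delta1 dE dR.
have [o [oE o_le]] := tree_free_orientation treeF freeG; rewrite Tl in o_le.
have nR : 0 < n%:R :> R by rewrite ltr0n.
pose L := [set u | (1 - eps) * n%:R <= \sum_v ((adj G u v)%:R : R)].
(* Otherwise [Q] and its common neighbors would contain a complete bipartite graph large enough for
   [F]. *)
have forbid (Q : {set 'I_n}) : (k < #|Q|)%N ->
    (#|[set v | [forall u in Q, adj G u v]]| <= l.*2)%N.
  move=> kQ; rewrite leqNgt; apply/negP => lQ; case/negP: freeG.
  apply: (@bipartite_copy _ _ F G A B Q [set v | [forall u in Q, adj G u v]]) => //.
  - rewrite disjoints_subset; apply/subsetP => u uQ; rewrite !inE.
    apply/negP => /forallP/(_ u); by rewrite uQ adj_irr.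
  - by move=> u v uQ; rewrite inE => /forallP/(_ u); rewrite uQ.
  - by rewrite Tl ltnW.
  - exact: leq_trans kQ.
have Lk : #|L| = k.
  have [y [y0 y1 y2]] := normalize_sqr x_ge0 x_gt0 eig.
  apply: (large_degree_card n_gt0 k_gt0 oE o_le y0 y1 r_gt0 y2 forbid tau0 n_le r_ge
    K_ge K_le exc eps0 eps1 tau1 gam1 keps).
  by rewrite -muln2 natrM; lra.
pose R0 := [set v | (v \notin L) && [forall u in L, adj G u v]].
pose E := [set v | (v \notin L) && (v \notin R0)].
have R0E : [set v | [forall u in L, adj G u v]] = R0.
  apply/setP => v; rewrite inE [RHS]inE; case: (boolP (v \in L)) => //= vL.
  by apply/negP => /forallP/(_ v); rewrite vL adj_irr.
have R0_ge : n%:R <= #|R0|%:R + k%:R * (eps * n%:R) :> R.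
  rewrite -R0E -Lk; apply: common_neighbors_ge => u.
  by rewrite inE; lra.
have kn : k%:R * (eps * n%:R) <= 1 / 2 * n%:R :> R.
  rewrite mulrA ler_wpM2r ?ler0n //; apply: le_trans keps.
  by rewrite ler_wpM2r ?ler_nat // ltW.
have R0_half : 1 / 2 * n%:R <= #|R0|%:R :> R by lra.
have lR0 : (l.*2 <= #|R0|)%N.
  by rewrite -(ler_nat R) -muln2 natrM; lra.
have LR0 : [disjoint L & R0].
  by rewrite disjoints_subset; apply/subsetP => u uL; rewrite in_setC inE uL.
have adjLR0 : {in L & R0, forall u v, adj G u v}.
  by move=> u v uL; rewrite inE => /andP[_ /forallP/(_ u)]; rewrite uL.
have cE : #|E|%:R <= k%:R * eps * n%:R :> R.
  have : (#|E| + #|R0| <= n)%N.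
    rewrite -[X in (_ <= X)%N]card_ord -cardsUI.
    have -> : E :&: R0 = set0.
      by apply/setP => v; rewrite in_setI in_set0 [v \in E]inE; case: (v \in R0); rewrite ?andbF.
    by rewrite cards0 addn0 max_card.
  rewrite -(ler_nat R) natrD; lra.
have [R0_nbr [e [ue eR0 se eP]]] := config L R0 Lk LR0 adjLR0 lR0.
have R0L v : v \in R0 -> v \notin L by rewrite inE => /andP[].
have [] := @S_bijection n k L e (fun u v => [&& u \in R0, v \in R0 & adj G u v]) Lk ue.
- by move=> v /eR0/R0L.
- by rewrite se; case: p p1 {config se} => [|[|]] // _; [left|right].
- by move=> u v _ _ /and3P[uR vR uv]; apply: eP.
rewrite se doubleK => f bf hom rS.
have [y [z [y0 y1 y2 y3]]] := normalize_max x_ge0 x_gt0 eig.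
apply: (@extremal_isomorphic R n k l G L o y z r delta Lk oE o_le y0 y1 y2 (ltW r_gt0)
   y3 R0_nbr delta1 r_gt0 _ p f k_gt0 delta0 _ bf _ rS).
- apply: le_trans dE; rewrite lerD2l ler_wpM2l ?lerD2r //.
  by rewrite addr_ge0 // addr_ge0 ?mulr_ge0 ?ler0n.
- rewrite -/R0; apply: lt_le_trans R0_half.
  apply: le_lt_trans (_ : delta * (l%:R + 1) * (2 * l%:R * n%:R) < _).
    rewrite ler_wpM2l ?mulr_ge0 ?addr_ge0 ?ler0n //.
    exact: (rho_sqr_le oE o_le y0 y1 y2 (ltW r_gt0) y3).
  by rewrite mulrA ltr_pM2r.
- by move=> u v /andP[uv h]; apply: hom.
Qed.

Lemma extremal_unique (R : realType) (l k : nat) : (0 < k)%N -> (k.+2 <= l)%N ->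
  exists N : nat, forall n, (N <= n)%N ->
  forall (T : finType) (F : sgraph T) (A B : {set T}) (p : nat) (G : sgraph 'I_n),
  #|T| = l -> is_tree F -> partite_sets F A B -> (#|A| <= k.+1)%N -> (p <= 1)%N ->
  is_free F G ->
  (forall L R0 : {set 'I_n}, #|L| = k -> [disjoint L & R0] ->
     {in L & R0, forall u v, adj G u v} -> (l.*2 <= #|R0|)%N -> join_config G L R0 p) ->
  rho R (S_graph n k p) <= rho R G -> isomorphic G (S_graph n k p).
Proof.
move=> k_gt0 kl.
have k1 : 1 <= k%:R :> R by rewrite ler1n.
have kl2 : k%:R + 2 <= l%:R :> R by rewrite -natrD ler_nat addn2.
have l3 : 3 <= l%:R :> R by lra.
have l_gt0 : 0 < l%:R :> R by lra.
(* The final gain, with [r^2 <= 2 l n] and [#|R0| >= n / 2], asks for [4 l (l + 1) delta < 1]. Then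
   [eps] keeps the contribution of [E] to the outer bound below [delta n / 6], and [tau] ensures
   [200 k^2 gam <= eps]. *)
pose delta : R := 1 / (8 * l%:R ^+ 2).
pose eps : R := delta / (24 * l%:R ^+ 2).
pose tau : R := eps / (200 * l%:R ^+ 2 * (l%:R + 3)).
have l2 : 9 <= l%:R ^+ 2 :> R.
  by have -> : 9 = 3 ^+ 2 :> R; [ring|rewrite ler_sqr ?nnegrE //; lra].
have l2_gt0 : 0 < l%:R ^+ 2 :> R by lra.
have delta_gt0 : 0 < delta by rewrite divr_gt0 //; lra.
have deltaE : 8 * l%:R ^+ 2 * delta = 1 by rewrite /delta; field; lra.
have eps_gt0 : 0 < eps by rewrite divr_gt0 //; lra.
have epsE : 24 * l%:R ^+ 2 * eps = delta by rewrite /eps; field; lra.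
have den_gt0 : 0 < 200 * l%:R ^+ 2 * (l%:R + 3) :> R by rewrite mulr_gt0 //; lra.
have tau_gt0 : 0 < tau by rewrite divr_gt0.
have tauE : 200 * l%:R ^+ 2 * ((l%:R + 3) * tau) = eps.
  by rewrite /tau; field; lra.
have gam_gt0 : 0 < (l%:R + 3) * tau by rewrite mulr_gt0 //; lra.
set gam := (l%:R + 3) * tau in tauE gam_gt0.
have delta1 : delta <= 1 / 72.
  have : 8 * 9 * delta <= 8 * l%:R ^+ 2 * delta by rewrite ler_pM2r //; lra.
  lra.
have leps : l%:R ^+ 2 * eps = delta / 24 by lra.
have le_lsq : l%:R <= l%:R ^+ 2 :> R by rewrite expr2 ler_peMr //; lra.
have leps1 : l%:R * eps <= 1 / 2.
  have : l%:R * eps <= l%:R ^+ 2 * eps by rewrite ler_pM2r.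
  lra.
have eps1 : eps <= 1 / 2.
  have : 1 * eps <= l%:R * eps by rewrite ler_pM2r //; lra.
  lra.
have tau1 : tau <= 1 / 2.
  rewrite /tau ler_pdivrMr //.
  have : 1 * 1 <= 200 * l%:R ^+ 2 * (l%:R + 3) :> R by rewrite ler_pM //; lra.
  lra.
clearbody tau eps delta.
pose K := Num.bound (2 * l%:R / tau ^+ 2).
have K_ge : 2 * l%:R <= K%:R * tau ^+ 2.
  rewrite -ler_pdivrMr ?exprn_gt0 //; apply/ltW/archi_boundP.
  by rewrite divr_ge0 ?mulr_ge0 ?exprn_ge0 ?ler0n ?(ltW tau_gt0).
(* [r >= Z] provides [K <= tau r] and [12 l <= delta r]; it follows from [n >= b1] since
   [r^2 >= n / 2]. The bound [b2] absorbs the [k^2] in [k (n - k)], and [b3] the exceptional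
   vertices. *)
pose Z : R := K%:R / tau + 12 * l%:R / delta.
have Z1 : K%:R / tau <= Z by rewrite lerDl divr_ge0 ?mulr_ge0 ?ler0n ?(ltW delta_gt0).
have Z2 : 12 * l%:R / delta <= Z by rewrite lerDr divr_ge0 ?ler0n ?(ltW tau_gt0).
have Z_gt0 : 0 < Z by apply: lt_le_trans Z2; rewrite divr_gt0 // mulr_gt0.
pose b1 : R := 2 * Z ^+ 2.
pose b2 : R := k%:R ^+ 2 / gam.
pose b3 : R := (2 ^ K * l.*2 * K)%:R / gam.
have b1_ge0 : 0 <= b1 by rewrite mulr_ge0 // sqr_ge0.
have b2_ge0 : 0 <= b2 by rewrite divr_ge0 ?sqr_ge0 // ltW.
have b3_ge0 : 0 <= b3 by rewrite divr_ge0 ?ler0n // ltW.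
exists (Num.bound b1 + Num.bound b2 + Num.bound b3 + 4 * l + 1)%N => n nN.
have [c1 c2 c3 c4] : [/\ Num.bound b1 <= n, Num.bound b2 <= n, Num.bound b3 <= n
    & 4 * l < n]%N.
  by move: nN; move: (Num.bound b1) (Num.bound b2) (Num.bound b3); clear; split; lia.
have bn (b : R) m : 0 <= b -> (Num.bound b <= m)%N -> b <= m%:R.
  by move=> b0 bm; apply/ltW/(lt_le_trans (archi_boundP b0)); rewrite ler_nat.
have b1n := bn b1 n b1_ge0 c1; have b2n := bn b2 n b2_ge0 c2.
have b3n := bn b3 n b3_ge0 c3.
have ln : 4 * l%:R < n%:R :> R by rewrite -natrM ltr_nat.
have kn : (k < n)%N by apply: leq_trans c4; clear -kl; lia.
have n_gt0 : (0 < n)%N by apply: leq_trans kn.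
have nR : 0 < n%:R :> R by rewrite ltr0n.
move=> T F A B p G Tl treeF AB Ak p1 freeG config rS.
clear nN c1 c2 c3 c4 bn b1_ge0 b2_ge0 b3_ge0 den_gt0 l2 l2_gt0 le_lsq.
have [x [x_ge0 x_gt0]] := graph_Perron R G n_gt0.
have := le_trans (rho_S_ge R p k_gt0 kn) (_ : _ <= rho R G ^+ 2).
rewrite ler_sqr ?nnegrE ?rho_ge0 // => /(_ rS).
move: (rho_ge0 R G) rS; move: (rho R G) => r r_ge0.
rewrite natrB; last exact: ltnW.
move=> + rk eig.
have r2n : 1 / 2 * n%:R <= r ^+ 2.
  apply: le_trans rk.
  have : 1 * (n%:R - k%:R) <= k%:R * (n%:R - k%:R) :> R by rewrite ler_wpM2r //; lra.
  lra.
have rZ : Z <= r.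
  rewrite -ler_sqr ?nnegrE ?(ltW Z_gt0) //; apply: le_trans r2n.
  by move: b1n; rewrite /b1; lra.
have r_gt0 : 0 < r by apply: lt_le_trans rZ.
have kg : k%:R ^+ 2 <= gam * n%:R by rewrite mulrC -ler_pdivrMr.
have rd : 12 * l%:R <= r * delta.
  by rewrite -ler_pdivrMr //; apply: le_trans rZ.
have r1 : 1 <= r.
  have : r * delta <= r * (1 / 72) by rewrite ler_pM2l.
  lra.
apply: (extremal_unique_of_bounds (K := K) (r := r) (eps := eps) (tau := tau) (delta := delta)
  n_gt0 k_gt0 p1 Tl treeF AB Ak freeG config x_ge0 x_gt0 eig r_gt0 tau_gt0) => //.
- lra.
- by move: kg rk; rewrite /gam; lra.
- by rewrite mulrC -ler_pdivrMr // (le_trans Z1 rZ).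
- by rewrite -/gam mulrC -ler_pdivrMr.
- have : tau ^+ 2 <= (1 / 2) ^+ 2 by rewrite ler_sqr ?nnegrE ?divr_ge0 ?(ltW tau_gt0).
  by have -> : (1 / 2) ^+ 2 = 1 / 4 :> R by [field]; lra.
- rewrite -/gam -tauE ler_pM2r // ler_pM2l // ler_sqr ?nnegrE //; lra.
- by apply: le_trans leps1; rewrite ler_pM2r // ler_nat ltnW.
- exact: ltW.
- lra.
- have h1 : r * k%:R <= 1 / 12 * (delta * r ^+ 2).
    have : r * (12 * k%:R) <= r * (r * delta) by rewrite ler_pM2l //; lra.
    rewrite expr2; lra.
  have h2 : (k%:R + 2 * l%:R + 2) * (k%:R * eps * n%:R + 1) <=
      4 * l%:R * (l%:R * eps * n%:R + 1).
    apply: ler_pM; rewrite ?addr_ge0 ?mulr_ge0 ?ler0n ?(ltW eps_gt0) //; first by lra.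
    rewrite lerD2r ler_pM2r // ler_pM2r //; lra.
  have h3 : 4 * l%:R * (l%:R * eps * n%:R + 1) = 4 * (l%:R ^+ 2 * eps) * n%:R + 4 * l%:R by ring.
  have h4 : delta * n%:R <= delta * (2 * r ^+ 2) by rewrite ler_pM2l //; lra.
  have h5 : 1 * (r * delta) <= r * (r * delta) by rewrite ler_pM2r // mulr_gt0.
  rewrite h3 leps in h2; move: h1 h2 h4 h5 rd; rewrite expr2; lra.
- have : delta * l%:R <= delta * (l%:R ^+ 2 / 3).
    rewrite ler_pM2l //; have : 3 * l%:R <= l%:R * l%:R :> R by rewrite ler_pM2r.
    rewrite expr2; lra.
  rewrite expr2 in deltaE *; lra.
Qed.

End Uniqueness.

(** * The structure of [R0] in a graph without a copy of the tree *)

Section Configurations.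
Variables (T V : finType) (F : sgraph T) (G : sgraph V) (A B : {set T}).
Variables (L R0 : {set V}).
Hypotheses (treeF : is_tree F) (AB : partite_sets F A B) (freeG : is_free F G).
Hypotheses (LR0 : [disjoint L & R0]) (adjLR0 : {in L & R0, forall u v, adj G u v}).
Hypotheses (TR0 : (#|T|.*2 <= #|R0|)%N) (AL : #|A| = #|L|.+1).

Let R0L v : v \in R0 -> v \notin L.
Proof. by move=> vR; rewrite (disjointFl LR0). Qed.

(** A leaf in [A] excludes every edge from [R0] to a vertex outside [L]. *)
Lemma even_config : (1 < #|T|)%N -> (#|T| <= #|A|.*2)%N -> join_config G L R0 0.
Proof.
move=> T1 TA; have [x xA dx] := partite_leaf treeF AB TA.
have noedge u v : u \in R0 -> v \notin L -> adj G u v = false.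
  move=> uR vL; apply/negP => uv; case/negP: freeG.
  by apply: (leaf_copy treeF AB LR0 adjLR0 TR0 xA dx T1 _ uR vL uv); rewrite AL.
split=> [v u1 u2 vL u1R _ vu1|].
  by rewrite adj_sym noedge in vu1.
exists [::]; split=> // u v uR vR; by rewrite noedge // R0L.
Qed.

(** By [path_copy] the edges inside [R0] form a matching, and by [two_edges_copy] this matching has
    at most one edge. *)
Lemma odd_config : {in A, forall a, degree F a = 2} -> #|B| = #|A|.+1 ->
  (1 < #|A|)%N -> join_config G L R0 1.
Proof.
move=> deg2 BA A1; have [x xA] : exists x, x \in A by apply/card_gt0P; apply: ltnW.
have nbr v u1 u2 : v \notin L -> u1 \in R0 -> u2 \in R0 ->
    adj G v u1 -> adj G v u2 -> u1 = u2.
  move=> vL u1R u2R vu1 vu2; apply/eqP; apply/negPn/negP => u12; case/negP: freeG.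
  apply: (path_copy AB LR0 adjLR0 TR0 xA (deg2 x xA) _ u1R u2R u12 vL vu1 vu2).
  by rewrite AL.
split=> //.
have [/existsP[u0 /existsP[v0 /and3P[u0R v0R uv0]]]|] :=
  boolP [exists u, exists v, [&& u \in R0, v \in R0 & adj G u v]].
  exists [:: u0; v0]; split=> //.
  - by rewrite /= inE andbT (adj_neq uv0).
  - by move=> w; rewrite !inE => /orP[] /eqP->.
  move=> u v uR vR uv; rewrite !inE; have vu := uv; rewrite adj_sym in vu.
  have vu0 := uv0; rewrite adj_sym in vu0.
  have [e|uu0] := eqVneq u u0.
    by rewrite (nbr u0 v v0) ?eqxx ?orbT ?R0L // -e.
  have [e|uv0'] := eqVneq u v0.
    by rewrite (nbr v0 v u0) ?eqxx ?R0L // -e.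
  have [e|vu0'] := eqVneq v u0.
    by move: uv0'; rewrite (nbr u0 u v0) ?eqxx ?R0L // -e.
  have [e|vv0] := eqVneq v v0.
    by move: uu0; rewrite (nbr v0 u u0) ?eqxx ?R0L // -e.
  case/negP: freeG.
  apply: (@two_edges_copy _ _ F G A B L R0 treeF AB LR0 adjLR0 TR0 u v u0 v0) => //.
  - by rewrite AL.
  - by move=> w; rewrite !inE => /or4P[] /eqP->.
  - rewrite /= !inE !negb_or uu0 uv0' vu0' vv0 (adj_neq uv) (adj_neq uv0) //.
rewrite negb_exists => /forallP noedge.
(* When [R0] spans no edge, any two of its vertices can serve as the ends of the extra edge. *)
have /card_gt1P[u0 [v0 [u0R v0R uv0]]] : (1 < #|R0|)%N.
  apply: leq_trans TR0; have := card_partite AB; lia.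
exists [:: u0; v0]; split=> //.
- by rewrite /= inE andbT.
- by move=> w; rewrite !inE => /orP[] /eqP->.
- move=> u v uR vR uv; have := noedge u; rewrite negb_exists => /forallP/(_ v).
  by rewrite uR vR uv.
Qed.

End Configurations.

(** * From uniqueness to the set of extremal graphs *)

Section ExtremalSet.
Variables (R : realType) (T : finType) (F : sgraph T) (n : nat) (H : sgraph 'I_n).

Lemma SPEX_is_free : SPEX_is R F H -> is_free F H.
Proof.
move=> /(_ H)[_ h].
have HH : isomorphic H H by exists id; first by exists id.
by have [] := h HH.
Qed.

Lemma is_free_iso (G : sgraph 'I_n) : isomorphic G H -> is_free F H -> is_free F G.
Proof.
move=> [g bg gE]; apply: contra => /existsP[f /andP[/injectiveP injf /forallP homf]].
apply/existsP; exists (finfun (g \o f)); apply/andP; split.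
  apply/injectiveP => s t; rewrite !ffunE /= => /(bij_inj bg); exact: injf.
apply/forallP => s; apply/forallP => t; apply/implyP => st; rewrite !ffunE /= -gE.
by have /forallP/(_ t)/implyP/(_ st) := homf s.
Qed.

(** The weak inequality is used twice: a graph of larger radius would be isomorphic to [H], so of
    equal radius, and a graph attaining [spex] is isomorphic to [H]. *)
Lemma SPEX_is_of_unique : (0 < n)%N -> is_free F H ->
  (forall G : sgraph 'I_n, is_free F G -> (rho R H <= rho R G)%R -> isomorphic G H) ->
  SPEX_is R F H.
Proof.
move=> n_gt0 freeH uniqH.
have spexE : rho R H = spex R n F.
  apply/le_anti/andP; split; first exact: (le_bigmax_cond _ (rho R (n:=n))).
  (* Nonnegativity of [rho] deals with the default value 0 of the maximum. *)
  apply: bigmax_le => [|G freeG]; first exact: rho_ge0.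
  rewrite leNgt; apply/negP => HG.
  by have := rho_iso R n_gt0 (uniqH G freeG (ltW HG)) => e; rewrite e ltxx in HG.
move=> G; split=> [[freeG rG]|GH].
  by apply: uniqH => //; rewrite rG spexE.
by split; [apply: is_free_iso GH freeH|rewrite (rho_iso R n_gt0 GH)].
Qed.

End ExtremalSet.

Theorem theorem1p3 (R : realType) (l : nat) (hl : (4 <= l)%N) :
  exists N : nat, forall n : nat, (N <= n)%N ->
  forall (T : finType) (F : sgraph T) (A B : {set T}),
    #|T| = l -> is_tree F -> partite_sets F A B -> (#|A| <= #|B|)%N ->
    (~~ odd l ->
       (SPEX_is R F (S_graph n ((l - 2) %/ 2) 0)
        <-> cover_number F = l %/ 2)) /\
    (odd l ->
       (SPEX_is R F (S_graph n ((l - 3) %/ 2) 1)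
        <-> cover_number F = (l - 1) %/ 2 /\ (2 <= min_degree_in F A)%N)).
Proof.
pose k := if odd l then ((l - 3) %/ 2)%N else ((l - 2) %/ 2)%N.
have [k_gt0 kl] : (0 < k)%N /\ (k.+2 <= l)%N.
  by rewrite /k; case: ifP => odd_l; split; lia.
have [N0 unique] := extremal_unique R k_gt0 kl.
exists (N0 + k + l.*2 + 1)%N => n nN T F A B Tl treeF AB leAB.
have [nN0 kn kTn] : [/\ N0 <= n, k < n & k + #|T|.*2 < n]%N by rewrite Tl; split; lia.
have n_gt0 : (0 < n)%N by apply: leq_ltn_trans kn.
have cAB := card_partite AB; rewrite Tl in cAB.
have coverA := cover_number_le (partite_cover AB).
have T1 : (1 < #|T|)%N by rewrite Tl; lia.
have cover_k p : is_free F (S_graph n k p) -> (k < cover_number F)%N.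
  move=> freeS; rewrite ltnNge; apply/negP => cF; case/negP: freeS.
  have kT : (k < #|T|)%N by rewrite Tl; lia.
  have [C covC Ck] := cover_number_ltP kT cF.
  exact: (S_cover_copy (ltnW kn) _ covC Ck kTn).
split=> [even_l|odd_l].
  have kE : ((l - 2) %/ 2)%N = k by rewrite /k (negPf even_l).
  have lE : l = k.+1.*2 by rewrite -kE; move: even_l hl; clear; lia.
  rewrite kE; have -> : (l %/ 2)%N = k.+1 by rewrite lE; clear; lia.
  split=> [/SPEX_is_free/cover_k cF|cF].
    by apply/eqP; rewrite eqn_leq cF andbT; apply: leq_trans coverA _; clear -cAB leAB lE; lia.
  (* [A] is a cover, so [#|A| >= k + 1], and the smaller partite set has at most half of the
     vertices. *)
  have Ak : #|A| = k.+1 by move: coverA; rewrite cF; clear -cAB leAB lE; lia.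
  apply: SPEX_is_of_unique => //; first by apply: (S0_free (ltnW kn)); rewrite cF.
  move=> G freeG; apply: (unique n nN0 T F A B) => //; first by rewrite Ak.
  move=> L R0 Lk LR0 adjLR0 lR0.
  by apply: (even_config treeF AB) => //; rewrite ?Tl ?Ak ?Lk // -?lE.
have kE : ((l - 3) %/ 2)%N = k by rewrite /k odd_l.
have lE : l = k.+1.*2.+1 by rewrite -kE; move: odd_l hl; clear; lia.
rewrite kE; have -> : ((l - 1) %/ 2)%N = k.+1 by rewrite lE; clear; lia.
have T2 : (2 <= #|T|)%N by [].
split=> [/SPEX_is_free freeS|[cF /(min_degree_inP F A T2) degA]].
  have cF : cover_number F = k.+1.
    apply/eqP; rewrite eqn_leq (cover_k _ freeS) andbT; apply: leq_trans coverA _.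
    by clear -cAB leAB lE; lia.
  split=> //; apply/(min_degree_inP F A T2) => x xA; rewrite ltnNge; apply/negP => dx.
  case/negP: freeS; apply: (S1_leaf_copy (ltnW kn) treeF AB xA dx T1 _ kTn).
  by clear -cAB leAB lE; lia.
have Ak : #|A| = k.+1 by move: coverA; rewrite cF; clear -cAB leAB lE; lia.
have deg2 : {in A, forall a, degree F a = 2}.
  by apply: (partite_degree2 treeF AB) => //; rewrite Tl Ak -lE.
apply: SPEX_is_of_unique => //.
  by apply: (S1_free (ltnW kn) treeF AB) => //; rewrite cF.
move=> G freeG; apply: (unique n nN0 T F A B) => //; first by rewrite Ak.
move=> L R0 Lk LR0 adjLR0 lR0.
apply: (odd_config treeF AB) => //; rewrite ?Tl ?Ak ?Lk //.
by clear -cAB Ak lE; lia.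
Qed.
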